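(* Let $k$ be an uncountable algebraically closed field. Let $X$ be an integral scheme of finite type over $k$, with $\sigma: X \to X$ a $k$-automorphism and $\sigma: k(X) \to k(X)$ the induced automorphism of the field of rational functions. Then the following are equivalent: (1) There exists a non-constant $\sigma$-invariant rational function $f \in k(X)$. (2) There exists a non-constant $\sigma^m$-invariant rational function $f \in k(X)$ for some $m \geq 1$. (3) $X$ has no dense $\sigma$-orbits. (4) $X$ has uncountably many maximal $\sigma$-irreducible closed subsets. (5) $X$ has uncountably many $\sigma$-irreducible closed subsets of codimension $1$.
   Context: Non-constant means $f \notin k$; the induced automorphism is $\sigma(f) = f \circ \sigma$. A $\sigma$-orbit is a set $\mathcal{O}_x = \{\sigma^n(x) \mid n \in \mathbb{Z}\}$ for a (closed) point $x \in X$; dense means Zariski dense in $X$. A closed subset $Z \subseteq X$ is $\sigma$-invariant if $\sigma(Z) = Z$. A nonempty $\sigma$-invariant closed subset $Z$ is $\sigma$-irreducible if there is no decomposition $Z = Z_1 \cup Z_2$ with $Z_1, Z_2 \subsetneq Z$ closed $\sigma$-invariant subsets. A maximal $\sigma$-irreducible closed subset of $X$ is a maximal element, under inclusion, of the set of all proper $\sigma$-irreducible closed subsets of $X$. *)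

(* Defs.v *)
From HB Require Import structures.
From mathcomp Require Import all_boot all_order all_algebra.
From mathcomp Require Import generic_quotient.
From mathcomp Require Import all_classical topology.

Set Implicit Arguments.
Unset Strict Implicit.
Unset Printing Implicit Defensive.

Import GRing.Theory.
Local Open Scope ring_scope.
Local Open Scope classical_set_scope.
Local Open Scope quotient_scope.

Record opens (X : topologicalType) := Opens {
  opens_set :> set X;
  opensP : open opens_set }.

Definition opens_setT (X : topologicalType) : opens X := Opens (@openT X).

Definition opens_setI (X : topologicalType) (U V : opens X) : opens X :=
  Opens (openI (opensP U) (opensP V)).

Definition opens_preimage (X : topologicalType) (f : X -> X)
    (cf : continuous f) (U : opens X) : opens X :=
  Opens (open_comp (fun x _ => cf x) (opensP U)).

(* Rings of sections are [comPzRingType]s: the zero ring must be allowed, being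
   the value of every sheaf of rings on the empty set. *)
Record ring_sheaf (X : topologicalType) := RingSheaf {
  sections :> opens X -> comPzRingType;
  restr : forall U V : opens X, V `<=` U -> {rmorphism sections U -> sections V};
  restr_id : forall (U : opens X) (UU : U `<=` U) (s : sections U),
    restr UU s = s;
  restr_comp : forall (U V W : opens X) (VU : V `<=` U) (WV : W `<=` V)
      (WU : W `<=` U) (s : sections U),
    restr WV (restr VU s) = restr WU s;
  sheaf_separated : forall (I : Type) (U : opens X) (V : I -> opens X)
      (VU : forall i, V i `<=` U) (s t : sections U),
    U `<=` \bigcup_i V i ->
    (forall i, restr (VU i) s = restr (VU i) t) -> s = t;
  sheaf_glue : forall (I : Type) (U : opens X) (V : I -> opens X)
      (VU : forall i, V i `<=` U) (s : forall i, sections (V i)),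
    U `<=` \bigcup_i V i ->
    (forall i j, restr (@subIsetl X (V i) (V j) : opens_setI _ _ `<=` _) (s i) =
                 restr (@subIsetr X (V i) (V j) : opens_setI _ _ `<=` _) (s j)) ->
    exists t : sections U, forall i, restr (VU i) t = s i }.

Arguments restr {X} r {U V}.

Definition prime_ideal (A : comPzRingType) (p : set A) :=
  [/\ p 0,
      forall a b, p a -> p b -> p (a + b),
      forall a b, p b -> p (a * b),
      ~ p 1
    & forall a b, p (a * b) -> p a \/ p b].

Record spec (A : comPzRingType) := Spec {
  spec_ideal : set A;
  specP : prime_ideal spec_ideal }.

HB.instance Definition _ (A : comPzRingType) := gen_eqMixin (spec A).
HB.instance Definition _ (A : comPzRingType) := gen_choiceMixin (spec A).

(* The complement of V(S). *)
Definition zariski_open (A : comPzRingType) (U : set (spec A)) :=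
  exists S : set A, U = [set p | ~ (S `<=` spec_ideal p)].

Lemma zariski_openT (A : comPzRingType) : zariski_open [set: spec A].
Proof.
exists [set 1]; apply/seteqP; split => // p _ /= h.
by case: (specP p) => _ _ _ n1 _; apply: n1; apply: h.
Qed.

Lemma zariski_openI (A : comPzRingType) (U V : set (spec A)) :
  zariski_open U -> zariski_open V -> zariski_open (U `&` V).
Proof.
move=> [S ->] [T ->]; exists [set a * b | a in S & b in T].
apply/seteqP; split => p /=.
  move=> [/existsNP[a /not_implyP[Sa pa]] /existsNP[b /not_implyP[Tb pb]]] h.
  have pab : spec_ideal p (a * b) by apply: h; exists a => //; exists b.
  by case: (specP p) => _ _ _ _ /(_ _ _ pab) [].
move=> h; case: (specP p) => _ _ pM _ _; split=> hS; apply: h => _ [a Sa [b Tb <-]].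
  by rewrite mulrC; apply: pM; apply: hS.
by apply: pM; apply: hS.
Qed.

Lemma zariski_open_bigU (A : comPzRingType) (I : Type) (f : I -> set (spec A)) :
  (forall i, zariski_open (f i)) -> zariski_open (\bigcup_i f i).
Proof.
move=> /choice[S fS]; exists (\bigcup_i S i); apply/seteqP; split => p /=.
  by move=> [i _]; rewrite fS /= => h hS; apply: h => a Sa; apply: hS; exists i.
move=> /existsNP[a /not_implyP[[i _ Sa] pa]].
by exists i => //; rewrite fS /= => /(_ _ Sa).
Qed.

HB.instance Definition _ (A : comPzRingType) := isOpenTopological.Build (spec A)
  (@zariski_openT A) (@zariski_openI A) (@zariski_open_bigU A).

Definition basic_open (A : comPzRingType) (f : A) : set (spec A) :=
  [set p | ~ spec_ideal p f].

(* [phi] exhibits [B] as the localization A_f. *)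
Definition is_localization (A B : comPzRingType) (f : A) (phi : A -> B) :=
  [/\ exists u : B, u * phi f = 1,
      forall b : B, exists a n, b * phi f ^+ n = phi a
    & forall a : A, phi a = 0 -> exists n, f ^+ n * a = 0].

(* (U, O|U) is isomorphic to Spec A: [psi] is a homeomorphism from Spec A onto
   U, and the structure sheaf of Spec A is the one with value A_f on D(f), which
   determines it because the D(f) form a basis closed under intersection. *)
Definition affine_open (X : topologicalType) (O : ring_sheaf X) (U : opens X) :=
  exists (A : comPzRingType) (psi : spec A -> X) (theta : {rmorphism A -> O U}),
    [/\ injective psi,
        range psi = U,
        continuous psi,
        forall V : set (spec A), open V -> open (psi @` V)
      & forall (f : A) (W : opens X) (WU : W `<=` U),
          W = psi @` basic_open f :> set X ->
          is_localization f (fun a => restr O WU (theta a))].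

(* Stalks need not be required to be local rings: this follows from
   [scheme_affine]. *)
Record scheme := Scheme {
  scheme_space :> topologicalType;
  scheme_sheaf : ring_sheaf scheme_space;
  scheme_affine : forall x : scheme_space,
    exists U : opens scheme_space, affine_open scheme_sheaf U /\ opens_set U x }.

Notation Gamma X U := (sections (scheme_sheaf X) U).

(* A morphism X -> Spec k amounts to a ring morphism from k to the global
   sections of X. *)
Record scheme_over (k : fieldType) := SchemeOver {
  base_scheme :> scheme;
  structure_map : {rmorphism k -> Gamma base_scheme (opens_setT base_scheme)} }.

Definition scalar (k : fieldType) (X : scheme_over k) (U : opens X) (c : k) :
    Gamma X U :=
  restr (scheme_sheaf X) (@subsetT X U : U `<=` opens_setT X)
    (structure_map X c).

Definition integral (X : scheme) :=
  [set: X] !=set0 /\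
  forall U : opens X, U !=set0 ->
    (1 : Gamma X U) <> 0 /\
    forall a b : Gamma X U, a * b = 0 -> a = 0 \/ b = 0.

(* A is generated as a k-algebra, with structure map [iota], by a finite set. *)
Definition finitely_generated (k : fieldType) (A : comPzRingType)
    (iota : k -> A) :=
  exists gens : seq A, forall B : set A,
    (forall c, B (iota c)) ->
    (forall a b, B a -> B b -> B (a + b)) ->
    (forall a b, B a -> B b -> B (a * b)) ->
    (forall a, a \in gens -> B a) ->
    B = setT.

Definition finite_type (k : fieldType) (X : scheme_over k) :=
  exists (n : nat) (U : 'I_n -> opens X),
    [set: X] `<=` \bigcup_i U i /\
    forall i, affine_open (scheme_sheaf X) (U i) /\
              finitely_generated (@scalar k X (U i)).

(* The maps induced on stalks are automatically
   local, being isomorphisms. *)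
Record automorphism (k : fieldType) (X : scheme_over k) := Automorphism {
  aut_fun :> X -> X;
  aut_inv : X -> X;
  aut_funK : cancel aut_fun aut_inv;
  aut_invK : cancel aut_inv aut_fun;
  aut_continuous : continuous aut_fun;
  aut_inv_continuous : continuous aut_inv;
  aut_comorph : forall U : opens X,
    {rmorphism Gamma X U -> Gamma X (opens_preimage aut_continuous U)};
  aut_comorph_bij : forall U : opens X, bijective (aut_comorph U);
  aut_comorph_restr : forall (U V : opens X) (VU : V `<=` U) (s : Gamma X U),
    aut_comorph V (restr (scheme_sheaf X) VU s) =
    restr (scheme_sheaf X)
      (@preimage_subset _ _ aut_fun V U VU :
        opens_preimage aut_continuous V `<=` opens_preimage aut_continuous U)
      (aut_comorph U s);
  aut_comorph_scalar : forall (U : opens X) (c : k),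
    aut_comorph U (scalar U c) = scalar (opens_preimage aut_continuous U) c }.

Arguments aut_comorph {k X} a {U}.

Section RationalFunctions.
Variables (k : fieldType) (X : scheme_over k).

Record ratgerm := RatGerm {
  germ_dom : opens X;
  germ_dense : dense germ_dom;
  germ_val : Gamma X germ_dom }.

HB.instance Definition _ := gen_eqMixin ratgerm.
HB.instance Definition _ := gen_choiceMixin ratgerm.

Definition ratgerm_eqv (g h : ratgerm) : bool :=
  `[< exists (W : opens X) (Wg : W `<=` germ_dom g) (Wh : W `<=` germ_dom h),
        dense W /\ restr (scheme_sheaf X) Wg (germ_val g) =
                   restr (scheme_sheaf X) Wh (germ_val h) >].

Lemma ratgerm_eqv_refl : reflexive ratgerm_eqv.
Proof.
move=> g; apply/asboolP; exists (germ_dom g), (@subset_refl _ _), (@subset_refl _ _).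
by split=> //; apply: germ_dense.
Qed.

Lemma ratgerm_eqv_sym : symmetric ratgerm_eqv.
Proof.
suff h g g' : ratgerm_eqv g g' -> ratgerm_eqv g' g.
  by move=> g g'; apply/idP/idP; apply: h.
move=> /asboolP[W [Wg [Wg' [dW e]]]]; apply/asboolP.
by exists W, Wg', Wg.
Qed.

Lemma ratgerm_eqv_trans : transitive ratgerm_eqv.
Proof.
move=> g2 g1 g3 /asboolP[V [V1 [V2 [dV eV]]]] /asboolP[W [W2 [W3 [dW eW]]]].
apply/asboolP.
have lV : opens_setI V W `<=` V by apply: subIsetl.
have lW : opens_setI V W `<=` W by apply: subIsetr.
exists (opens_setI V W), (subset_trans lV V1), (subset_trans lW W3); split.
  move=> Q Q0 oQ; rewrite /= setIA; apply: dW.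
    exact: dV.
  by apply: openI => //; apply: opensP.
rewrite -(restr_comp V1 lV) eV -(restr_comp W3 lW) -eW.
rewrite (restr_comp V2 lV (subset_trans lV V2)).
exact/esym/restr_comp.
Qed.

Canonical ratgerm_equivRel :=
  EquivRel ratgerm_eqv ratgerm_eqv_refl ratgerm_eqv_sym ratgerm_eqv_trans.

(* The elements of k(X); on an integral scheme "dense open" means
   "nonempty open". *)
Definition ratfun := {eq_quot ratgerm_eqv}.

Lemma dense_opens_setT : dense (opens_setT X).
Proof. by move=> Q Q0 _; rewrite setIT. Qed.

Definition ratconst (c : k) : ratfun :=
  \pi_ratfun (RatGerm dense_opens_setT (scalar (opens_setT X) c)).

Variable sigma : automorphism X.

Lemma dense_aut_preimage (U : opens X) :
  dense U -> dense (opens_preimage (@aut_continuous _ _ sigma) U).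
Proof.
move=> dU Q [q Qq] oQ.
have [|//|y []] := dU (aut_inv sigma @^-1` Q).
- by exists (sigma q); rewrite /= aut_funK.
- by apply: open_comp => // x _; apply: aut_inv_continuous.
- by exists (aut_inv sigma y); split=> //=; rewrite aut_invK.
Qed.

Definition germ_pullback (g : ratgerm) : ratgerm :=
  RatGerm (dense_aut_preimage (@germ_dense g))
    (aut_comorph sigma (germ_val g)).

Definition ratfun_pullback (f : ratfun) : ratfun :=
  \pi_ratfun (germ_pullback (repr f)).

Lemma ratfun_pullback_pi (g : ratgerm) :
  ratfun_pullback (\pi_ratfun g) = \pi_ratfun (germ_pullback g).
Proof.
rewrite /ratfun_pullback; apply/eqmodP => /=.
have /eqmodP/= : repr (\pi_ratfun g) = g %[mod ratfun] by rewrite reprK.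
move: (repr _) => h /asboolP[W [Wh [Wg [dW e]]]]; apply/asboolP.
exists (opens_preimage (@aut_continuous _ _ sigma) W).
exists (preimage_subset (f := sigma) Wh), (preimage_subset (f := sigma) Wg).
split; first exact: dense_aut_preimage.
by rewrite /= -!aut_comorph_restr e.
Qed.

End RationalFunctions.

Definition nonconstant (k : fieldType) (X : scheme_over k) (f : ratfun X) :=
  ~ exists c : k, f = ratconst X c.

Section Dynamics.
Variables (k : fieldType) (X : scheme_over k) (sigma : automorphism X).

Definition aut_iter (n : int) : X -> X :=
  match n with
  | Posz m => iter m sigma
  | Negz m => iter m.+1 (aut_inv sigma)
  end.

Definition aut_orbit (x : X) : set X := [set aut_iter n x | n in [set: int]].

Definition aut_invariant (Z : set X) := sigma @` Z = Z.

Definition aut_irreducible (Z : set X) :=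
  [/\ closed Z, Z !=set0, aut_invariant Z
    & ~ exists Z1 Z2 : set X,
        [/\ closed Z1 /\ closed Z2, aut_invariant Z1 /\ aut_invariant Z2,
            Z1 `<` Z /\ Z2 `<` Z & Z = Z1 `|` Z2]].

Definition maximal_aut_irreducible (Z : set X) :=
  [/\ aut_irreducible Z, Z <> setT
    & forall Y, aut_irreducible Y -> Y <> setT -> Z `<=` Y -> Y = Z].

End Dynamics.

Section Codimension.
Variable X : topologicalType.

Definition irreducible_closed (Z : set X) :=
  [/\ closed Z, Z !=set0
    & ~ exists Z1 Z2 : set X,
        [/\ closed Z1 /\ closed Z2, Z1 `<` Z /\ Z2 `<` Z & Z = Z1 `|` Z2]].

(* There is a chain Z = Z_0 < Z_1 < ... < Z_n of irreducible closed subsets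
   of X, that is, codim(Z, X) >= n. *)
Definition codim_chain (Z : set X) (n : nat) :=
  exists c : nat -> set X,
    [/\ c 0%N = Z,
        forall i, (i <= n)%N -> irreducible_closed (c i)
      & forall i, (i < n)%N -> c i `<` c i.+1].

(* For a closed set Y, codim(Y, X) is the infimum of codim(Z, X) over the
   irreducible closed subsets Z of Y. *)
Definition has_codim (Y : set X) (n : nat) :=
  (exists Z, [/\ irreducible_closed Z, Z `<=` Y, codim_chain Z n
                & ~ codim_chain Z n.+1]) /\
  (forall Z, irreducible_closed Z -> Z `<=` Y -> codim_chain Z n).

End Codimension.

(* Main.v *)
From mathcomp Require Import all_boot all_order all_algebra.
From mathcomp Require Import generic_quotient.
From mathcomp Require Import ring.
From mathcomp Require Import all_classical topology.
Require Import Defs.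

(* If all invariant rational functions are constant, then there is a countable set
   of nonzero germs of functions, one of which vanishes on Z for each invariant
   closed subset Z <> X.  Indeed let e_0, e_1, ... span the functions on an
   affine open set over k, and let j = sum c_i a_i be a nonzero combination of
   them vanishing on Z.  Then sigma(j) a_0 - j sigma(a_0) also
   vanishes on Z and has fewer terms, the new coefficients being
   sigma(a_i) a_0 - a_i sigma(a_0).  Iterating, either some a_0 vanishes on Z, or
   at some stage the expression is zero; then j / a_0 is invariant, hence
   constant, and a_0 vanishes on Z again.  So there are countably many nonempty
   open sets one of which is missed by each Z.  As k is uncountable, some closed
   point lies in all of them, and its orbit is dense; and as X is noetherian,
   there are only countably many maximal sigma-irreducible closed sets.

   Conversely, a sigma^m-invariant function f takes at most m values on the orbit
   of a closed point, so no such orbit is dense if f is not constant.  For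
   all but countably many c some height one prime contains f - c; the closures of
   the orbits of the corresponding points are distinct sigma-irreducible sets of
   codimension one.  Finally those are maximal sigma-irreducible. *)

Set Implicit Arguments.
Unset Strict Implicit.
Unset Printing Implicit Defensive.

Import GRing.Theory.
Local Open Scope ring_scope.
Local Open Scope classical_set_scope.
Local Open Scope quotient_scope.

(** * Ideals *)

Section Ideals.
Variable B : comPzRingType.
Implicit Types (I P S : set B).

(** Uncountability of [k] enters through a single count: uncountably many elements of an algebra of
    countable dimension are linearly dependent over [k]. Applied to fractions [s / (f - c)] modulo a
    prime, with [s] in a countable multiplicative set, it gives a relative form of the
    Nullstellensatz, and this form is what places one closed point in countably many open sets at
    once. Applied to fractions [tau / (f - c)], with [tau] in a subalgebra over which [f] is
    transcendental, it shows that for all but countably many [c] the ideal of [f - c] meets that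
    subalgebra only in 0. This is where the exceptional [c] come from, and it lets transcendence
    take the place of dimension theory in producing primes of height one. *)

Definition ideal I :=
  [/\ I 0, forall a b, I a -> I b -> I (a + b) & forall a b, I b -> I (a * b)].

Lemma prime_is_ideal P : prime_ideal P -> ideal P.
Proof. by case. Qed.

Lemma ideal_opp I a : ideal I -> I a -> I (- a).
Proof. by case=> _ _ IM Ia; rewrite -mulN1r; apply: IM. Qed.

Lemma ideal_sub I a b : ideal I -> I a -> I b -> I (a - b).
Proof. by move=> iI Ia Ib; case: (iI) => _ ID _; apply/ID/(ideal_opp iI). Qed.

Lemma ideal_mulr I a b : ideal I -> I a -> I (a * b).
Proof. by case=> _ _ IM Ia; rewrite mulrC; apply: IM. Qed.

Lemma ideal_sum I (J : Type) (r : seq J) (Q : pred J) (F : J -> B) : ideal I ->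
  (forall j, Q j -> I (F j)) -> I (\sum_(j <- r | Q j) F j).
Proof. by case=> I0 ID _ IF; elim/big_ind: _. Qed.

Lemma ideal_addKr I a b : ideal I -> I b -> I (a + b) -> I a.
Proof. by move=> iI Ib /ideal_sub/(_ Ib); rewrite addrK; apply. Qed.

Lemma primeX P a n : prime_ideal P -> P (a ^+ n) -> P a.
Proof.
case=> P0 PD PM P1 Pp; elim: n => [|n IH]; first by rewrite expr0.
by rewrite exprS => /Pp[].
Qed.

Lemma prime_prod P (J : Type) (r : seq J) (Q : pred J) (F : J -> B) :
  prime_ideal P -> P (\prod_(j <- r | Q j) F j) -> exists2 j, Q j & P (F j).
Proof.
case=> P0 PD PM P1 Pp; elim/big_rec: _ => [//|j b Qj IH /Pp[Pj|/IH//]].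
by exists j.
Qed.

Definition mult_closed_set S := S 1 /\ forall a b, S a -> S b -> S (a * b).

(** The last clause, that [P] together with any [b] outside it generates an ideal meeting [S], is
    what the Nullstellensatz consumes. *)
Lemma prime_avoiding I S : ideal I -> mult_closed_set S ->
  (forall a, I a -> S a -> False) ->
  exists P, [/\ prime_ideal P, I `<=` P, forall a, P a -> S a -> False &
    forall b, ~ P b -> exists p u s, [/\ P p, S s & p + u * b = s]].
Proof.
move=> iI [S1 SM] IS.
pose Q (J : set B) := J = set0 \/ [/\ ideal J, I `<=` J & forall a, J a -> S a -> False].
have [F FQ Ftot|P [QP Pmax]] := @Zorn_bigcup B Q.
  have [[J0 [FJ0 [a0 J0a0]]]|noF] := pselect (exists J, F J /\ J !=set0); last first.
    left; apply/seteqP; split => // a [J FJ Ja].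
    by apply: noF; exists J; split => //; exists a.
  have FI J a : F J -> J a -> [/\ ideal J, I `<=` J & forall a, J a -> S a -> False].
    by move=> /FQ[->|].
  have [[J00 J0D J0M] IJ0 _] := FI _ _ FJ0 J0a0.
  right; split; last by move=> a [J FJ Ja]; have [_ _] := FI _ _ FJ Ja; apply.
    split.
    - by exists J0.
    - move=> a b [J FJ Ja] [K FK Kb].
      have [[_ JD _] _ _] := FI _ _ FJ Ja; have [[_ KD _] _ _] := FI _ _ FK Kb.
      by have [h|h] := Ftot _ _ FJ FK; [exists K => //; apply: KD => //; apply: h
        |exists J => //; apply: JD => //; apply: h].
    - move=> a b [J FJ Jb]; have [[_ _ JM] _ _] := FI _ _ FJ Jb.
      by exists J => //; apply: JM.
  by move=> a Ia; exists J0 => //; apply: IJ0.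
have P0 : P !=set0.
  apply: contrapT => /set0P/negP; rewrite negbK => /eqP Pe.
  apply: (Pmax I); last by right; split.
  by rewrite Pe; split=> // /(_ 0); apply; case: iI.
case: QP => [Pe|[iP IP PS]]; first by case: P0 => a; rewrite Pe.
have mx b : ~ P b -> exists p u s, [/\ P p, S s & p + u * b = s].
  move=> Pb; apply: contrapT => H.
  pose J := [set c | exists p u, P p /\ p + u * b = c].
  case: (iP) => PI0 PID PIM.
  apply: (Pmax J); last right.
    split; first by move=> p Pp; exists p, 0; rewrite mul0r addr0.
    move=> h; apply: Pb; apply: h; exists 0, 1; split => //.
    by rewrite mul1r add0r.
  split.
  - split; first by exists 0, 0; rewrite mul0r addr0.
      move=> _ _ [p [u [Pp <-]]] [q [v [Pq <-]]]; exists (p + q), (u + v).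
      by rewrite mulrDl addrACA; split=> //; apply: PID.
    move=> a _ [p [u [Pp <-]]]; exists (a * p), (a * u).
    by rewrite mulrDr mulrA; split=> //; apply: PIM.
  - by move=> a Ia; exists a, 0; rewrite mul0r addr0; split=> //; apply: IP.
  - by move=> _ [p [u [Pp <-]]] Ss; apply: H; exists p, u, (p + u * b).
exists P; split => //; case: (iP) => PI0 PID PIM; split => //.
  by move=> P1; apply: PS P1 S1.
move=> a b Pab; apply: contrapT => /not_orP[/mx[p [u [s [Pp Ss e]]]] /mx[q [v [t [Pq St f]]]]].
apply: (PS (s * t)); last exact: SM.
rewrite -e -f.
have -> : (p + u * a) * (q + v * b) = (q + v * b) * p + (u * a) * q + (u * v) * (a * b) by ring.
by apply: (PID); [apply: PID|]; apply: PIM.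
Qed.

End Ideals.

(** * Hilbert's basis theorem *)

Section Algebra.
Variables (k : fieldType) (B : comPzRingType) (iota : {rmorphism k -> B}).
Implicit Types (T P S : set B).

Definition subalgebra T :=
  [/\ forall c, T (iota c), forall a b, T a -> T b -> T (a + b)
    & forall a b, T a -> T b -> T (a * b)].

Lemma subalgebra0 T : subalgebra T -> T 0.
Proof. by case=> Tc _ _; rewrite -(rmorph0 iota). Qed.

Lemma subalgebra1 T : subalgebra T -> T 1.
Proof. by case=> Tc _ _; rewrite -(rmorph1 iota). Qed.

Lemma subalgebraN T a : subalgebra T -> T a -> T (- a).
Proof.
case=> Tc _ TM Ta; rewrite -mulN1r -(rmorph1 iota) -rmorphN; exact: TM.
Qed.

Lemma subalgebra_range : subalgebra (range iota).
Proof.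
split; first by move=> c; exists c.
  by move=> _ _ [c _ <-] [d _ <-]; exists (c + d); rewrite ?rmorphD.
by move=> _ _ [c _ <-] [d _ <-]; exists (c * d); rewrite ?rmorphM.
Qed.

(** Polynomials in [y] of degree less than [n], as a subset of [B]: with all subalgebras kept inside
    [B], no polynomial ring over a varying coefficient ring is formed. *)
Definition poly_expr T y n : set B :=
  [set x | exists t : nat -> B, (forall i, T (t i)) /\ x = \sum_(i < n) t i * y ^+ i].

Definition adjoin T y : set B := [set x | exists n, poly_expr T y n x].

Section PolynomialExpressions.
Variables (T : set B) (y : B).
Hypothesis sT : subalgebra T.

Lemma poly_expr0 n : poly_expr T y n 0.
Proof.
exists (fun=> 0); split; first by move=> _; apply: subalgebra0.
by rewrite big1 // => i _; rewrite mul0r.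
Qed.

Lemma poly_exprD n a b : poly_expr T y n a -> poly_expr T y n b -> poly_expr T y n (a + b).
Proof.
move=> [s [Ts ->]] [t [Tt ->]]; exists (fun i => s i + t i); split.
  by case: sT => _ TD _ i; apply: TD.
by rewrite -big_split; apply: eq_bigr => i _; rewrite mulrDl.
Qed.

Lemma poly_exprZ n a b : T a -> poly_expr T y n b -> poly_expr T y n (a * b).
Proof.
move=> Ta [t [Tt ->]]; exists (fun i => a * t i); split.
  by case: sT => _ _ TM i; apply: TM.
by rewrite mulr_sumr; apply: eq_bigr => i _; rewrite mulrA.
Qed.

Lemma poly_exprB n a b : poly_expr T y n a -> poly_expr T y n b -> poly_expr T y n (a - b).
Proof.
move=> pa pb; apply: poly_exprD => //; rewrite -mulN1r; apply: poly_exprZ => //.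
exact: (subalgebraN sT (subalgebra1 sT)).
Qed.

Lemma poly_exprMy n a : poly_expr T y n a -> poly_expr T y n.+1 (y * a).
Proof.
move=> [t [Tt ->]]; exists (fun i => if i is j.+1 then t j else 0); split.
  by case=> [|i] //; apply: subalgebra0.
rewrite big_ord_recl mul0r add0r mulr_sumr; apply: eq_bigr => i _ /=.
by rewrite /bump /= add1n exprS mulrCA.
Qed.

Lemma poly_exprS n a : poly_expr T y n a -> poly_expr T y n.+1 a.
Proof.
move=> [t [Tt ->]]; exists (fun i => if (i < n)%N then t i else 0); split.
  by move=> i; case: ifP => // _; apply: subalgebra0.
rewrite big_ord_recr /= ltnn mul0r addr0; apply: eq_bigr => i _.
by rewrite ltn_ord.
Qed.

Lemma poly_exprW n m a : (n <= m)%N -> poly_expr T y n a -> poly_expr T y m a.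
Proof.
move=> /subnK <- pa; elim: (m - n)%N => // d IH; rewrite addSn; exact: poly_exprS.
Qed.

Lemma poly_expr_recr n a : poly_expr T y n.+1 a ->
  exists2 t, T t & poly_expr T y n (a - t * y ^+ n).
Proof.
move=> [t [Tt ->]]; exists (t n) => //.
by rewrite big_ord_recr /= addrK; exists t.
Qed.

Lemma poly_exprX n t : T t -> poly_expr T y n.+1 (t * y ^+ n).
Proof.
move=> Tt; elim: n => [|n IH]; last first.
  by rewrite exprS mulrCA; apply: poly_exprMy.
exists (fun=> t); split=> //; by rewrite big_ord_recl big_ord0 addr0.
Qed.

Lemma adjoin_sub : T `<=` adjoin T y.
Proof. by move=> t Tt; exists 1%N; have := poly_exprX 0 Tt; rewrite mulr1. Qed.

Lemma adjoin_gen : adjoin T y y.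
Proof.
by exists 2%N; have := @poly_exprX 1 1 (subalgebra1 sT); rewrite mul1r.
Qed.

Lemma adjoinD a b : adjoin T y a -> adjoin T y b -> adjoin T y (a + b).
Proof.
move=> [n pa] [m pb]; exists (maxn n m); apply: poly_exprD.
  by apply: poly_exprW pa; rewrite leq_maxl.
by apply: poly_exprW pb; rewrite leq_maxr.
Qed.

Lemma adjoinM a b : adjoin T y a -> adjoin T y b -> adjoin T y (a * b).
Proof.
move=> [n pa] pb; elim: n a pa => [|n IH] a.
  by move=> [t [_ ->]]; rewrite big_ord0 mul0r; exists 0%N; apply: poly_expr0.
move=> [t [Tt ->]]; rewrite big_ord_recl mulrDl; apply: adjoinD.
  by case: pb => m pb; rewrite mulr1; exists m; apply: poly_exprZ.
have [|m pm] := IH (\sum_(i < n) t i.+1 * y ^+ i).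
  by exists (fun i => t i.+1).
exists m.+1; have := poly_exprMy pm; rewrite mulrA; congr poly_expr; congr (_ * _).
by rewrite mulr_sumr; apply: eq_bigr => i _; rewrite /= /bump /= add1n exprS mulrCA.
Qed.

Lemma subalgebra_adjoin : subalgebra (adjoin T y).
Proof.
split; [|exact: adjoinD|exact: adjoinM] => c.
by apply: adjoin_sub; case: sT.
Qed.

End PolynomialExpressions.

Definition relative_ideal T (I : set B) :=
  [/\ I `<=` T, I 0, forall a b, I a -> I b -> I (a + b)
    & forall a b, T a -> I b -> I (a * b)].

Definition ascending_chain_condition T := forall J : nat -> set B,
  (forall n, relative_ideal T (J n)) -> (forall n, J n `<=` J n.+1) ->
  exists N, forall n, (N <= n)%N -> J n `<=` J N.

Lemma acc_range : ascending_chain_condition (range iota).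
Proof.
move=> J iJ _; have [[n /nonsubset[a [Ja a0]]]|H] := pselect (exists n, ~ J n `<=` [set 0]).
  have [Jr J0 JD JM] := iJ n.
  exists n => m _ x Jx; have [Jr' _ _ _] := iJ m.
  case: (Jr _ Ja) => c _ ca; case: (Jr' _ Jx) => d _ <-.
  have c0 : c != 0 by apply/eqP => c0; apply: a0; rewrite -ca c0 rmorph0.
  rewrite -[d](divfK c0) rmorphM ca; apply: JM => //; by exists (d / c).
exists 0%N => n _ x Jx; have [_ J0 _ _] := iJ 0%N.
apply: contrapT => J0x; apply: H; exists n => /(_ _ Jx) x0.
by apply: J0x; rewrite x0.
Qed.

Lemma chain_le (J : nat -> set B) : (forall n, J n `<=` J n.+1) ->
  forall n m, (n <= m)%N -> J n `<=` J m.
Proof.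
move=> JS n m /subnK <-; elim: (m - n)%N => [|d IH]; first by [].
by rewrite addSn; apply: subset_trans IH _.
Qed.

(* Hilbert's argument, with [L d I] the ideal of leading coefficients of the
   elements of [I] which are polynomials of degree at most [d] in [g]. *)
Lemma acc_adjoin T g : subalgebra T -> ascending_chain_condition T ->
  ascending_chain_condition (adjoin T g).
Proof.
move=> sT aT J iJ JS.
pose L d (I : set B) := [set r | T r /\ exists2 x, I x & poly_expr T g d (x - r * g ^+ d)].
have LI d n : relative_ideal T (L d (J n)).
  have [Jsub J0 JD JM] := iJ n; case: (sT) => Tc TD TM; split.
  - by move=> r [].
  - split; first exact: subalgebra0.
    by exists 0 => //; rewrite mul0r subr0; apply: poly_expr0.
  - move=> a b [Ta [x Jx px]] [Tb [z Jz pz]]; split; first exact: TD.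
    exists (x + z); first exact: JD.
    by rewrite mulrDl opprD addrACA; apply: poly_exprD.
  - move=> a b Ta [Tb [x Jx px]]; split; first exact: TM.
    exists (a * x); first by apply: JM => //; apply: adjoin_sub.
    by rewrite -mulrA -mulrBr; apply: poly_exprZ.
have LS d n : L d (J n) `<=` L d.+1 (J n).
  have [Jsub J0 JD JM] := iJ n => r [Tr [x Jx px]]; split=> //.
  exists (g * x); first by apply: JM => //; apply: adjoin_gen.
  by rewrite exprS mulrCA -mulrBr; apply: poly_exprMy.
have LJ d n m : (n <= m)%N -> L d (J n) `<=` L d (J m).
  by move=> nm r [Tr [x Jx px]]; split=> //; exists x => //; apply: chain_le Jx.
have Lmon d n d' n' : (d <= d')%N -> (n <= n')%N -> L d (J n) `<=` L d' (J n').
  move=> dd nn; apply: subset_trans (LJ _ _ _ nn) _.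
  exact: (@chain_le (fun d => L d (J n'))).
have [m0 Hm0] : exists m0, forall m, (m0 <= m)%N -> L m (J m) `<=` L m0 (J m0).
  by apply: aT => // n; apply: Lmon.
have /choice[N HN] : forall d, exists N, forall n, (N <= n)%N -> L d (J n) `<=` L d (J N).
  by move=> d; apply: (aT (fun n => L d (J n))) => // n; apply: LJ.
(* Row [d < m0] is stationary from [N d] on, and the sum bounds all these indices; the rows from
   [m0] on are controlled by the stationary diagonal. *)
pose M := (m0 + \sum_(d < m0) N d)%N.
have HM d n : (M <= n)%N -> L d (J n) `<=` L d (J M).
  move=> Mn; have [dm|md] := ltnP d m0.
    apply: (@subset_trans _ (L d (J (N d)))); last apply: LJ.
      apply: HN; apply: leq_trans Mn.
      by rewrite /M (bigD1 (Ordinal dm)) //= addnCA leq_addr.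
    by rewrite /M (bigD1 (Ordinal dm)) //= addnCA leq_addr.
  apply: (@subset_trans _ (L m0 (J m0))); last by apply: Lmon => //; apply: leq_addr.
  apply: (@subset_trans _ (L (maxn d n) (J (maxn d n)))).
    by apply: Lmon; rewrite ?leq_maxl ?leq_maxr.
  by apply: Hm0; rewrite leq_max md.
exists M => n Mn x Jx; have [Jsub J0 JD JM] := iJ n.
have [e pe] := Jsub _ Jx; elim: e x Jx pe => [|e IH] x Jx pe.
  by case: pe => t [_ ->]; rewrite big_ord0; case: (iJ M).
have [t Tt pt] := poly_expr_recr pe.
have [_ [z Jz pz]] : L e (J M) t by apply: HM Mn _ _; split=> //; exists x.
(* [z] has the same leading term as [x], so the induction applies to [x - z]. *)
rewrite -(subrK z x); case: (iJ M) => _ _ MD _; apply: MD => //.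
apply: IH; last first.
  have -> : x - z = (x - t * g ^+ e) - (z - t * g ^+ e) by ring.
  exact: poly_exprB.
rewrite -mulN1r; apply: JD => //; apply: JM; last exact: chain_le Jz.
by apply: (adjoin_sub g sT); exact: (subalgebraN sT (subalgebra1 sT)).
Qed.

Lemma finitely_generated_acc : finitely_generated iota -> ascending_chain_condition setT.
Proof.
move=> [gens Hg].
pose G := foldr (fun g R => adjoin R g) (range iota) gens.
have sub l : subalgebra (foldr (fun g R => adjoin R g) (range iota) l).
  by elim: l => [|g l IH] /=; [exact: subalgebra_range|exact: subalgebra_adjoin].
have <- : G = setT.
  case: (sub gens) => Gc GD GM; apply: Hg => //.
  rewrite /G; elim: gens {G Gc GD GM} => // g l IH a; rewrite inE => /orP[/eqP->|al] /=.
    exact: adjoin_gen.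
  by apply: adjoin_sub => //; apply: IH.
rewrite /G; elim: gens {Hg G} => [|g l IH] /=; first exact: acc_range.
exact: acc_adjoin.
Qed.

End Algebra.

(** * Linear dependence and transcendence *)

Section Span.
Variables (k : fieldType) (B : comPzRingType) (iota : {rmorphism k -> B}).

Definition finspan (e : nat -> B) : set B :=
  [set b | exists n (c : nat -> k), b = \sum_(i < n) iota (c i) * e i].

Definition countably_spanned := exists e : nat -> B, finspan e = setT.

Lemma finspan0 e : finspan e 0.
Proof. by exists 0%N, (fun=> 0); rewrite big_ord0. Qed.

Lemma finspanDgen e b (c : k) i : finspan e b -> finspan e (iota c * e i + b).
Proof.
move=> [n [d ->]]; exists (maxn n i.+1).
exists (fun j => (if j == i then c else 0) + (if (j < n)%N then d j else 0)).
under [RHS]eq_bigr do rewrite rmorphD mulrDl.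
rewrite big_split /=; congr (_ + _).
  have im : (i < maxn n i.+1)%N by rewrite leq_maxr.
  rewrite (bigD1 (Ordinal im)) //= eqxx big1 ?addr0 // => j ji.
  by rewrite ifN ?rmorph0 ?mul0r //; apply: contra ji => /eqP ji; apply/eqP/val_inj.
rewrite (big_ord_widen _ (fun i => iota (d i) * e i) (leq_maxl n i.+1)) big_mkcond /=.
by apply: eq_bigr => j _; case: ifP => // _; rewrite rmorph0 mul0r.
Qed.

Lemma countably_spannedP (I : countType) (e : I -> B) :
  (forall b, exists l : seq (k * I), b = \sum_(x <- l) iota x.1 * e x.2) ->
  countably_spanned.
Proof.
(* Numbers that code no index get the zero vector. *)
move=> He; exists (fun n => if choice.unpickle n is Some i then e i else 0).
apply/seteqP; split=> // b _; have [l ->] := He b.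
elim: l => [|[c i] l IH]; first by rewrite big_nil; apply: finspan0.
rewrite big_cons /=; have := finspanDgen c (choice.pickle i) IH.
by rewrite choice.pickleK.
Qed.

Lemma finitely_generated_monomials : finitely_generated iota ->
  exists e : seq nat -> B,
  forall b, exists l : seq (k * seq nat), b = \sum_(x <- l) iota x.1 * e x.2.
Proof.
move=> [gens Hg]; pose e w := \prod_(i <- w) nth 0 gens i; exists e => b.
pose M := [set b | exists l : seq (k * seq nat), b = \sum_(x <- l) iota x.1 * e x.2].
suff MT : M = setT by have : M b by rewrite MT.
apply: Hg.
- move=> c; exists [:: (c, [::])]; by rewrite big_seq1 /e big_nil mulr1.
- by move=> _ _ [l ->] [l' ->]; exists (l ++ l'); rewrite big_cat.
- move=> _ _ [l ->] [l' ->].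
  exists [seq (x.1 * y.1, x.2 ++ y.2) | x <- l, y <- l'].
  rewrite big_allpairs_dep /= mulr_suml; apply: eq_bigr => x _.
  rewrite mulr_sumr; apply: eq_bigr => y _.
  by rewrite /e big_cat rmorphM mulrACA.
- move=> a /(nthP 0)[i _ <-]; exists [:: (1, [:: i])].
  by rewrite big_seq1 /e big_seq1 rmorph1 mul1r.
Qed.

Lemma dependent_of_span n (e : nat -> B) (u : 'I_n.+1 -> B) (c : 'I_n.+1 -> nat -> k) :
  (forall i, u i = \sum_(j < n) iota (c i j) * e j) ->
  exists2 v : 'I_n.+1 -> k, (exists i, v i != 0) & \sum_i iota (v i) * u i = 0.
Proof.
move=> uE; pose M : 'M[k]_(n.+1, n) := \matrix_(i, j) c i j.
have /rowV0Pn[w wM w0] : kermx M != 0.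
  by rewrite kermx_eq0 -row_leq_rank -ltnNge ltnS rank_leq_col.
exists (fun i => w 0 i).
  apply/existsP; apply: contra_neqT w0; rewrite negb_exists => /forallP h.
  by apply/rowP => i; rewrite mxE; apply/eqP; have := h i; rewrite negbK.
have wM0 : w *m M = 0 by apply/sub_kermxP.
under eq_bigr => i _ do rewrite uE mulr_sumr.
rewrite exchange_big big1 //= => j _.
under eq_bigr do rewrite mulrA -rmorphM.
rewrite -mulr_suml -rmorph_sum; have := congr1 (fun A : 'rV_n => A 0 j) wM0.
rewrite !mxE; under eq_bigr do rewrite mxE.
by move=> ->; rewrite rmorph0 mul0r.
Qed.

(** Each [u x] lies in the span of the first [n] generators for some [n]. On an uncountable set some
    [n = m] occurs infinitely often, and any [m + 1] of the corresponding values are dependent. *)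
Lemma dependent_of_uncountable (C : set k) (u : k -> B) :
  countably_spanned -> ~ countable C ->
  exists n (g : 'I_n.+1 -> k) (v : 'I_n.+1 -> k),
    [/\ injective g, forall i, C (g i), exists i, v i != 0
      & \sum_i iota (v i) * u (g i) = 0].
Proof.
move=> [e eT] nC.
have /choice[n] : forall x, exists n, exists c : nat -> k,
    u x = \sum_(i < n) iota (c i) * e i.
  by move=> x; have : finspan e (u x) by rewrite eT.
move=> /choice[c uE].
have [m nCm] : exists m, ~ finite_set (C `&` [set x | n x = m]).
  apply: contrapT => /forallNP h; apply: nC.
  have -> : C = \bigcup_m (C `&` [set x | n x = m]).
    apply/seteqP; split=> x; last by case=> m _ [].
    by exists (n x).
  apply: bigcup_countable => // m _; apply: finite_set_countable.
  exact: contrapT.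
have [F FC Fm] := infinite_set_fset m.+1 nCm.
pose g (i : 'I_m.+1) := nth 0 (finmap.enum_fset F) i.
have gF (i : 'I_m.+1) : g i \in finmap.enum_fset F.
  by apply: mem_nth; apply: leq_trans Fm.
have ng i : n (g i) = m by case: (FC (g i)) => //; exact: gF.
have [|v v0 vu] := @dependent_of_span m e (u \o g) (fun i => c (g i)).
  by move=> i /=; rewrite uE ng.
exists m, g, v; split => //; last by move=> i; case: (FC (g i)) => //; exact: gF.
move=> i j /eqP; rewrite nth_uniq ?finmap.fset_uniq //; last 2 first.
- exact: leq_trans (ltn_ord i) Fm.
- exact: leq_trans (ltn_ord j) Fm.
by move=> /eqP/val_inj.
Qed.
End Span.

(** * Transcendence over a subalgebra, modulo a prime *)

Section Transcendence.
Variables (k : fieldType) (B : comPzRingType) (iota : {rmorphism k -> B}).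
Implicit Types (T P S : set B).

(** The coefficients have to be 0 and not merely in [P]; the case of a single coefficient says that
    [T] meets [P] at most in 0. *)
Definition transcendental P T f := forall n (t : nat -> B), (forall i, T (t i)) ->
  P (\sum_(i < n) t i * f ^+ i) -> forall i, (i < n)%N -> t i = 0.

(** [(f - c) ^ i] is [f ^ i] plus lower powers of [f], so rewriting in powers of [f] keeps the top
    coefficient, and coefficients are eliminated from the top. *)
Lemma transcendental_shift P T f c : subalgebra iota T ->
  transcendental P T f -> transcendental P T (f - iota c).
Proof.
move=> sT tr; set y := f - iota c; case: (sT) => Tc TD TM.
have ymonic i : poly_expr T f i (y ^+ i - f ^+ i).
  elim: i => [|i IH]; first by rewrite subrr; apply: (poly_expr0 _ sT).
  have -> : y ^+ i.+1 - f ^+ i.+1 =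
      f * (y ^+ i - f ^+ i) + iota (- c) * ((y ^+ i - f ^+ i) + 1 * f ^+ i).
    by rewrite rmorphN !exprS /y; ring.
  apply: (poly_exprD sT); first exact: (poly_exprMy sT).
  apply: (poly_exprZ sT) => //; apply: (poly_exprD sT); first exact: (poly_exprS sT).
  exact: (poly_exprX _ sT _ (subalgebra1 sT)).
have ypol n (t : nat -> B) : (forall i, T (t i)) -> poly_expr T f n (\sum_(i < n) t i * y ^+ i).
  move=> Tt; elim: n => [|n IH]; first by rewrite big_ord0; apply: (poly_expr0 _ sT).
  rewrite big_ord_recr /=; apply: (poly_exprD sT); first exact: (poly_exprS sT).
  apply: (poly_exprZ sT) => //; rewrite -(subrK (f ^+ n) (y ^+ n)).
  apply: (poly_exprD sT); first exact: (poly_exprS sT).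
  by rewrite -[X in poly_expr _ _ _ X]mul1r; apply: (poly_exprX _ sT _ (subalgebra1 sT)).
move=> n t Tt; elim: n => [//|n IH] h.
have [s [Ts sE]] : poly_expr T f n (\sum_(i < n) t i * y ^+ i + t n * (y ^+ n - f ^+ n)).
  by apply: (poly_exprD sT); [exact: ypol|exact: (poly_exprZ sT)].
have tn0 : t n = 0.
  have := tr n.+1 (fun i => if i == n then t n else s i).
  move=> /(_ _ _ n (ltnSn n)); rewrite eqxx; apply.
    by move=> i; case: ifP.
  rewrite big_ord_recr /= eqxx.
  have -> : \sum_(i < n) (if i == n :> nat then t n else s i) * f ^+ i =
            \sum_(i < n) s i * f ^+ i.
    by apply: eq_bigr => i _; rewrite ltn_eqF.
  by rewrite -sE -addrA -mulrDr subrK; move: h; rewrite big_ord_recr.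
move=> i; rewrite ltnS leq_eqVlt => /orP[/eqP->//|]; apply: IH.
by move: h; rewrite big_ord_recr /= tn0 mul0r addr0.
Qed.

(* The coefficients [u] with [u (f - c) = s tau] are linearly dependent, and
   clearing denominators in a relation among them gives an equation for [f]. *)
Lemma countable_nonlift P T f s : prime_ideal P -> subalgebra iota T ->
  transcendental P T f -> countably_spanned iota -> ~ P s ->
  countable [set c | exists u tau,
    [/\ T tau, tau <> 0 & P (u * (f - iota c) - s * tau)]].
Proof.
move=> pP sT tr span Ps; apply: contrapT; set C := [set c | _] => nC.
have /choice[u] : forall c, exists u, exists tau, C c ->
    [/\ T tau, tau <> 0 & P (u * (f - iota c) - s * tau)].
  move=> c; have [[u [tau h]]|nCc] := pselect (C c); first by exists u, tau.
  by exists 0, 0 => /nCc.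
move=> /choice[tau H].
have [n [g [v [ginj gC [i0 vi0] vu]]]] := dependent_of_uncountable u span nC.
pose y := f - iota (g i0); have trY := transcendental_shift (c := g i0) sT tr.
pose d i := iota (g i0 - g i).
have fE i : f - iota (g i) = y + d i by rewrite /y /d rmorphB addrA subrK.
pose Pi i := \prod_(j | j != i) (y + d j).
case: (sT) => Tc TD TM; have iP := prime_is_ideal pP.
(* Multiplying the linear relation by all the [f - g j], and replacing [u (g i) * (f - g i)] by
   [s * tau (g i)], puts [s * X] in [P]. *)
pose X := \sum_i iota (v i) * tau (g i) * Pi i.
have PX : P X.
  have [] // : P s \/ P X; case: (pP) => P0 PD PM _; apply.
  have -> : s * X = - \sum_i iota (v i) * Pi i * (u (g i) * (f - iota (g i)) - s * tau (g i)).
    have E : \sum_i iota (v i) * u (g i) * ((y + d i) * Pi i) = 0.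
      transitivity ((\sum_i iota (v i) * u (g i)) * \prod_j (y + d j)).
        2: by rewrite vu mul0r.
      rewrite mulr_suml.
      by apply: eq_bigr => i _; rewrite [in RHS](bigD1 i).
    apply/eqP; rewrite -subr_eq0 opprK; apply/eqP; rewrite -[RHS]E mulr_sumr -big_split.
    by apply: eq_bigr => i _; rewrite /= fE; ring.
  apply: ideal_opp => //; apply: ideal_sum => // i _; apply: PM.
  by case: (H _ (gC i)).
have sA := subalgebra_adjoin y sT; case: (sA) => Ac AD AM.
have AT := adjoin_sub y sT.
pose E a := exists2 x, adjoin T y x & a = y * x.
have AP (Q : pred 'I_n.+1) : adjoin T y (\prod_(j | Q j) (y + d j)).
  elim/big_ind: _ => [|//|j _]; first exact: subalgebra1 sA.
  by apply: (AD); [exact: (adjoin_gen y sT)|exact: Ac].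
have E1 : exists2 x, adjoin T y x & Pi i0 = \prod_(j | j != i0) d j + y * x.
  suff [] : adjoin T y (\prod_(j | j != i0) d j) /\
      exists2 x, adjoin T y x & Pi i0 = \prod_(j | j != i0) d j + y * x by [].
  rewrite /Pi; elim/big_rec2: _ => [|j a b _ [Ab [x Ax e]]].
    split; first exact: subalgebra1 sA.
    by exists 0; rewrite ?mulr0 ?addr0 //; exact: subalgebra0 sA.
  split; first by apply: (AM) => //; exact: Ac.
  exists (b + (y + d j) * x); last by rewrite e; ring.
  apply: (AD) => //; apply: (AM) => //; apply: (AD); last exact: Ac.
  exact: (adjoin_gen y sT).
have E2 i : i != i0 -> E (Pi i).
  move=> ii0; rewrite /Pi (bigD1 i0) 1?eq_sym //= /d subrr rmorph0 addr0.
  by exists (\prod_(j | (j != i) && (j != i0)) (y + d j)).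
(* [w * tau (g i0)] is the constant term of [X] in powers of [y]: as [d i0] is 0, every [Pi i] with
   [i != i0] is divisible by [y]. *)
pose w := v i0 * \prod_(j | j != i0) (g i0 - g j).
have w0 : w != 0.
  rewrite mulf_neq0 //; apply/prodf_neq0 => j ji0; rewrite subr_eq0.
  by apply: contra ji0 => /eqP/ginj ->.
have [x [m [t [Tt xE]]] XE] : exists2 x, adjoin T y x & X = iota w * tau (g i0) + y * x.
  rewrite /X (bigD1 i0) //=.
  have [x2 Ax2 ->] : E (\sum_(i < n.+1 | i != i0) iota (v i) * tau (g i) * Pi i).
    elim/big_rec: _ => [|i a ii0 [x Ax ->]].
      by exists 0; rewrite ?mulr0 //; exact: subalgebra0 sA.
    have [z Az ->] := E2 _ ii0; exists (iota (v i) * tau (g i) * z + x); last by ring.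
    apply: (AD) => //; apply: (AM) => //; apply: (AM); first exact: Ac.
    by apply: AT; case: (H _ (gC i)).
  have [x1 Ax1 ->] := E1; exists (iota (v i0) * tau (g i0) * x1 + x2).
    apply: (AD) => //; apply: (AM) => //; apply: (AM); first exact: Ac.
    by apply: AT; case: (H _ (gC i0)).
  by rewrite rmorphM rmorph_prod; ring.
have := trY m.+1 (fun i => if i is j.+1 then t j else iota w * tau (g i0)).
move=> /(_ _ _ 0%N isT) => h.
have [Tt0 t0 _] := H _ (gC i0); apply: t0.
rewrite -[tau _]mul1r -(rmorph1 iota) -(mulVf w0) rmorphM -mulrA h ?mulr0 //.
  by case=> [|i] //; apply: TM.
rewrite big_ord_recl mulr1.
suff <- : X = iota w * tau (g i0) + \sum_(i < m) t i * y ^+ bump 0 i by [].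
rewrite XE xE mulr_sumr; congr (_ + _); apply: eq_bigr => i _.
by rewrite /bump add1n exprS mulrCA.
Qed.

End Transcendence.

(** * Nullstellensatz over an uncountable field *)

Section Nullstellensatz.
Variables (k : closedFieldType) (B : comPzRingType) (iota : {rmorphism k -> B}).
Implicit Types (T P S : set B).

(** Polynomials over an algebraically closed field split, so a prime containing a nonzero polynomial
    in [f] would contain some [f - c]. *)
Lemma transcendental_scalars P f : prime_ideal P ->
  (forall c, ~ P (f - iota c)) -> transcendental P (range iota) f.
Proof.
move=> pP fP.
pose ev N (q : {poly k}) := \sum_(i < N) iota q`_i * f ^+ i.
have evW N (q : {poly k}) : (size q <= N)%N -> ev N q = ev (size q) q.
  move=> sN; rewrite /ev (big_ord_widen _ (fun i => iota q`_i * f ^+ i) sN).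
  rewrite [RHS]big_mkcond; apply: eq_bigr => i _ /=.
  by case: ltnP => // /(nth_default 0) ->; rewrite rmorph0 mul0r.
have evXsub N (q : {poly k}) z : (size q <= N)%N ->
    ev N.+1 (q * ('X - z%:P)) = ev N q * (f - iota z).
  move=> sN; have -> : ev N.+1 (q * ('X - z%:P)) =
      \sum_(i < N.+1) iota (q * 'X)`_i * f ^+ i - iota z * ev N.+1 q.
    rewrite /ev mulr_sumr -sumrB; apply: eq_bigr => i _.
    by rewrite mulrBr coefB coefMC rmorphB rmorphM; ring.
  rewrite (evW N.+1) ?(leqW sN) // -(evW N) // big_ord_recl coefMX eqxx rmorph0 mul0r add0r.
  rewrite mulrBr [iota z * _]mulrC; congr (_ - _); rewrite /ev mulr_suml.
  by apply: eq_bigr => i _; rewrite coefMX /= exprSr mulrA.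
have evP m (q : {poly k}) : (size q <= m)%N -> q != 0 -> ~ P (ev (size q) q).
  elim: m q => [|m IH] q sq q0.
    by move: sq; rewrite leqn0 size_poly_eq0 (negPf q0).
  have [/size_poly1P[c c0 ->]|/closed_rootP[z /factor_theorem[r qE]]] := boolP (size q == 1%N).
    rewrite /ev size_polyC c0 big_ord1 mulr1 coefC /= => Pc.
    case: (pP) => _ _ PM P1 _; apply: P1.
    by rewrite -(rmorph1 iota) -(mulVf c0) rmorphM; apply: PM.
  have r0 : r != 0 by apply: contra_neq q0; rewrite qE => ->; rewrite mul0r.
  have szq : size q = (size r).+1.
    by rewrite qE size_Mmonic ?monicXsubC // size_XsubC addn2.
  rewrite szq qE evXsub //; case: (pP) => _ _ _ _ Pp /Pp[|]; last exact: fP.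
  by apply: IH => //; rewrite -ltnS -szq.
move=> n t tT Pt.
have /choice[c ct] : forall i, exists c, iota c = t i by move=> i; case: (tT i) => c _ <-; exists c.
pose q := \poly_(i < n) c i.
have q0 : q = 0.
  apply/eqP/negPn/negP => q0; apply: (evP _ _ (leqnn _) q0).
  rewrite -(evW n) ?size_poly //; suff -> : ev n q = \sum_(i < n) t i * f ^+ i by [].
  by apply: eq_bigr => i _; rewrite coef_poly ltn_ord ct.
move=> i ni; have := congr1 (fun p : {poly k} => p`_i) q0.
by rewrite coef_poly ni coef0 -ct => ->; rewrite rmorph0.
Qed.

(** If no [f - c] is in [P], maximality makes each [f - c] divide an element of [S] modulo [P]. By
    [countable_nonlift], with the scalars as [T], each of the countably many [s] serves only
    countably many [c]. The usual Nullstellensatz is the case [S = [set 1]]. *)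
Lemma nullstellensatz P S : ~ countable [set: k] -> countably_spanned iota ->
  countable S -> prime_ideal P -> (forall a, P a -> S a -> False) ->
  (forall b, ~ P b -> exists p u s, [/\ P p, S s & p + u * b = s]) ->
  forall f, exists c, P (f - iota c).
Proof.
move=> nk span cS pP PS Pmax f; apply: contrapT => /forallNP fP.
have tr := transcendental_scalars pP fP; apply: nk.
have -> : [set: k] = \bigcup_(s in S) [set c | exists u tau,
    [/\ range iota tau, tau <> 0 & P (u * (f - iota c) - s * tau)]].
  apply/seteqP; split=> // c _; have [p [u [s [Pp Ss e]]]] := Pmax _ (fP c).
  exists s => //; exists u, 1; split; first by exists 1; rewrite ?rmorph1.
    by move=> h; case: (pP) => P0 _ _ P1 _; apply: P1; rewrite h.
  have -> : u * (f - iota c) - s * 1 = - p by rewrite -e; ring.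
  exact: (ideal_opp (prime_is_ideal pP)).
apply: bigcup_countable => // s Ss.
apply: countable_nonlift => //; first exact: subalgebra_range.
by move=> Ps; apply: PS Ps Ss.
Qed.

End Nullstellensatz.

(** * Primes of height one *)

Section HeightOne.
Variables (k : closedFieldType) (B : comPzRingType) (iota : {rmorphism k -> B}).
Implicit Types (T P Q : set B).
Hypothesis B1 : (1 : B) <> 0.
Hypothesis Bdomain : forall a b : B, a * b = 0 -> a = 0 \/ b = 0.

Lemma prime_ideal0 : prime_ideal [set (0 : B)].
Proof.
split => //=; first by move=> a b -> ->; rewrite addr0.
by move=> a b ->; rewrite mulr0.
Qed.

(** Since [h] is in [P], the constant coefficient is in [P], hence 0; then [h] cancels modulo [Q]
    and the degree drops. *)
Lemma transcendental_mod Q T h P : prime_ideal P -> prime_ideal Q ->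
  (forall t, T t -> P t -> t = 0) -> Q `<=` P -> P h -> ~ Q h ->
  transcendental Q T h.
Proof.
move=> pP pQ TP QP Ph Qh; elim=> [//|n IH] t Tt Qt.
have E : \sum_(i < n.+1) t i * h ^+ i = t 0%N + h * \sum_(i < n) t i.+1 * h ^+ i.
  rewrite big_ord_recl mulr1 mulr_sumr; congr (_ + _); apply: eq_bigr => i _.
  by rewrite /= /bump add1n exprS mulrCA.
have t0 : t 0%N = 0.
  apply: TP => //; apply: (@ideal_addKr _ _ _ (h * \sum_(i < n) t i.+1 * h ^+ i)).
  - exact: prime_is_ideal.
  - exact: (ideal_mulr _ (prime_is_ideal pP) Ph).
  - by rewrite -E; apply: QP.
move: Qt; rewrite E t0 add0r; case: (pQ) => _ _ _ _ Qp /Qp[//|Qs] [//|i] ni.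
by apply: (IH (fun i => t i.+1)) => // j; apply: Tt.
Qed.

(** Since [y] is in [Q], the constant coefficient is an expression in [h] lying in [Q], hence 0;
    then [y] cancels because [B] is a domain. *)
Lemma transcendental_adjoin Q T h y : prime_ideal Q -> subalgebra iota T ->
  transcendental Q T h -> y <> 0 -> Q y ->
  transcendental [set 0] (adjoin T h) y.
Proof.
move=> pQ sT tr y0 Qy; elim=> [//|n IH] r Tr /= r0.
have E : \sum_(i < n.+1) r i * y ^+ i = r 0%N + y * \sum_(i < n) r i.+1 * y ^+ i.
  rewrite big_ord_recl mulr1 mulr_sumr; congr (_ + _); apply: eq_bigr => i _.
  by rewrite /= /bump add1n exprS mulrCA.
have r00 : r 0%N = 0.
  have [m [t [Tt tE]]] := Tr 0%N.
  rewrite tE big1 // => i _; rewrite (tr m t Tt) ?mul0r // -tE.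
  apply: (@ideal_addKr _ _ _ (y * \sum_(i < n) r i.+1 * y ^+ i)).
  - exact: prime_is_ideal.
  - exact: (ideal_mulr _ (prime_is_ideal pQ) Qy).
  - by rewrite -E r0; case: pQ.
move: r0; rewrite E r00 add0r => /Bdomain[//|rs] [//|i] ni.
by apply: (IH (fun i => r i.+1)) => // j; apply: Tr.
Qed.

Lemma transcendental_exchange T h y : subalgebra iota T ->
  transcendental [set 0] T y -> transcendental [set 0] (adjoin T y) h ->
  transcendental [set 0] (adjoin T h) y.
Proof.
move=> sT trY trh n r Tr r0 i ni.
have /choice[m] : forall i, exists m, exists t : nat -> B,
    (forall j, T (t j)) /\ r i = \sum_(j < m) t j * h ^+ j by move=> j; exact: Tr.
move=> /choice[t tE].
pose M := \max_(i < n) m i.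
have mM (j : 'I_n) : (m j <= M)%N by apply: (leq_bigmax j).
pose s i j := if (j < m i)%N then t i j else 0.
have Ts i' j : T (s i' j).
  by rewrite /s; case: ifP => _; [case: (tE i')|exact: subalgebra0 sT].
have rE (i' : 'I_n) : r i' = \sum_(j < M) s i' j * h ^+ j.
  case: (tE i') => _ ->.
  rewrite (big_ord_widen _ (fun j => t i' j * h ^+ j) (mM i')) big_mkcond.
  by apply: eq_bigr => j _; rewrite /s; case: ifP => // _; rewrite mul0r.
have s0 j : (j < M)%N -> \sum_(i < n) s i j * y ^+ i = 0.
  apply: (trh M (fun j => \sum_(i < n) s i j * y ^+ i)).
    by move=> j'; exists n, (fun i => s i j').
  rewrite /= -[RHS]r0; under [RHS]eq_bigr => i' _ do rewrite rE mulr_suml.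
  rewrite exchange_big /=; apply: eq_bigr => j' _; rewrite mulr_suml.
  by apply: eq_bigr => i' _; rewrite mulrAC.
rewrite (rE (Ordinal ni)) big1 // => j _ /=.
rewrite (trY n (fun i => s i j)) ?mul0r //; last exact: s0.
Qed.

Lemma maximal_transcendental f : transcendental [set 0] (range iota) f ->
  exists T, [/\ subalgebra iota T, transcendental [set 0] T f &
    forall h, transcendental [set 0] (adjoin T h) f -> T h].
Proof.
move=> trk; pose good T := subalgebra iota T /\ transcendental [set 0] T f.
pose R T := T = set0 \/ good T.
have [F FR Ftot|T [RT Tmax]] := @Zorn_bigcup B R.
  have [[J0 [FJ0 [a0 J0a0]]]|noF] := pselect (exists J, F J /\ J !=set0); last first.
    left; apply/seteqP; split => // a [J FJ Ja].
    by apply: noF; exists J; split => //; exists a.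
  have Fg J a : F J -> J a -> good J by move=> /FR[->|].
  right; have [sJ0 _] := Fg _ _ FJ0 J0a0.
  (* Finitely many elements of the union lie in one member of the chain; it also contains 0, which
     pads the coefficient sequence beyond [n]. *)
  have common n (t : nat -> B) : (forall i, (\bigcup_(X in F) X) (t i)) ->
      exists2 J, F J & J 0 /\ forall i, (i < n)%N -> J (t i).
    move=> Ft; elim: n => [|n [J FJ [J00 Jt]]].
      by exists J0 => //; split=> //; exact: subalgebra0 sJ0.
    have [K FK Kt] := Ft n; have [JK|KJ] := Ftot _ _ FJ FK.
      exists K => //; split; first exact: JK.
      by move=> i; rewrite ltnS leq_eqVlt => /orP[/eqP->//|/Jt/JK].
    exists J => //; split=> //.
    by move=> i; rewrite ltnS leq_eqVlt => /orP[/eqP->|/Jt//]; exact: KJ.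
  split; last first.
    move=> n t /(common n)[J FJ [J00 Jt]] /= e i ni.
    have [_ trJ] := Fg _ _ FJ J00.
    have := trJ n (fun j => if (j < n)%N then t j else 0).
    move=> /(_ _ _ i ni) /=; rewrite ni; apply.
      by move=> j; case: ifP => //; exact: Jt.
    by rewrite -[RHS]e; apply: eq_bigr => j _; rewrite ltn_ord.
  split; first by move=> c; exists J0 => //; case: sJ0.
    move=> a b Fa Fb; have [|J FJ [J00 Jt]] := common 2%N (fun i => if i is 0%N then a else b).
      by case.
    have [[_ JD _] _] := Fg _ _ FJ J00.
    by exists J => //; apply: JD; [exact: (Jt 0%N)|exact: (Jt 1%N)].
  move=> a b Fa Fb; have [|J FJ [J00 Jt]] := common 2%N (fun i => if i is 0%N then a else b).
    by case.
  have [[_ _ JM] _] := Fg _ _ FJ J00.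
  by exists J => //; apply: JM; [exact: (Jt 0%N)|exact: (Jt 1%N)].
case: RT => [T0|[sT trT]].
  case: (Tmax (range iota)); last by right; split=> //; exact: subalgebra_range.
  by rewrite T0; split=> // /(_ 0); apply; exists 0; rewrite ?rmorph0.
exists T; split=> // h trh; apply: contrapT => Th.
apply: (Tmax (adjoin T h)); last first.
  by right; split=> //; exact: (subalgebra_adjoin h sT).
split; first exact: (adjoin_sub h sT).
by move=> /(_ h); move=> H; apply: Th; apply: H; exact: (adjoin_gen h sT).
Qed.

(* [T] plays the part of a transcendence basis containing [f - c] with [f - c]
   removed: a prime containing [f - c] and disjoint from [T \ {0}] has height
   one, because a prime strictly between 0 and it would yield an element [h] outside
   [T] with [f] still transcendental over [T[h]]. *)
Lemma height_one_fibres f : ~ countable [set: k] -> countably_spanned iota ->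
  (forall c, f <> iota c) ->
  exists2 C : set k, ~ countable C & forall c, C c -> exists P,
    [/\ prime_ideal P, P (f - iota c) & forall Q, prime_ideal Q -> Q `<=` P ->
        P `<=` Q \/ Q `<=` [set 0]].
Proof.
move=> nk span fk.
have p0 := prime_ideal0.
have trk : transcendental [set 0] (range iota) f.
  apply: transcendental_scalars => // c /= /eqP; rewrite subr_eq0 => /eqP; exact: fk.
have [T [sT trT Tmax]] := maximal_transcendental trk.
(* For [c] outside [bad], the ideal generated by [f - c] avoids the nonzero elements of [T];
   [countable_nonlift] is used with the zero prime and [s = 1]. *)
pose bad := [set c | exists u tau,
    [/\ T tau, tau <> 0 & [set 0] (u * (f - iota c) - 1 * tau)]].
have cbad : countable bad by apply: countable_nonlift.
exists (~` bad).
  move=> cC; apply: nk; rewrite -(setvU bad).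
  have -> : ~` bad `|` bad = \bigcup_(b in [set: bool]) (if b then bad else ~` bad).
    apply/seteqP; split=> x; first by case=> h; [exists false|exists true].
    by case=> -[] _ h; [right|left].
  by apply: bigcup_countable => //; case.
move=> c nbad; set y := f - iota c.
have y0 : y <> 0 by move=> /eqP; rewrite subr_eq0 => /eqP; exact: fk.
pose S := [set t | T t /\ t <> 0].
have SM : mult_closed_set S.
  split; first by split=> //; exact: subalgebra1 sT.
  move=> a b [Ta a0] [Tb b0]; split; first by case: sT => _ _; apply.
  by move=> /Bdomain[].
pose I := [set a | exists u, a = u * y].
have iI : ideal I.
  split; first by exists 0; rewrite mul0r.
    by move=> _ _ [u ->] [v ->]; exists (u + v); rewrite mulrDl.
  by move=> a _ [u ->]; exists (a * u); rewrite mulrA.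
have [_ [u ->] [Tt t0]|P [pP IP PS _]] := prime_avoiding iI SM.
  by apply: nbad; exists u, (u * y); split=> //=; rewrite mul1r subrr.
have Py : P y by apply: IP; exists 1; rewrite mul1r.
exists P; split=> // Q pQ QP; apply: contrapT => /not_orP[nPQ nQ0].
have [h1 [Ph1 Qh1]] := nonsubset nPQ.
have [h0 [Qh0 h00]] := nonsubset nQ0.
have TP t : T t -> P t -> t = 0.
  by move=> Tt Pt; apply: contrapT => t0; apply: (PS t).
have yf h : transcendental [set 0] (adjoin T h) y -> T h.
  move=> try; apply: Tmax; have -> : f = y - iota (- c) by rewrite rmorphN opprK subrK.
  by apply: transcendental_shift try; exact: subalgebra_adjoin.
(* An element of [P] outside [Q] and a nonzero element of [Q] are algebraically independent over
   [T]. In each case one of the two is [y]; the other then lies in [T] by maximality, and in [P], so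
   it is 0. *)
have [Qy|Qy] := pselect (Q y).
  have Th1 : T h1.
    apply: yf; apply: (transcendental_adjoin pQ) => //.
    exact: (transcendental_mod pP).
  by apply: Qh1; rewrite (TP _ Th1 Ph1); case: pQ.
have trY := transcendental_shift (c := c) sT trT.
have Th0 : T h0.
  apply: yf; apply: transcendental_exchange => //.
  apply: (transcendental_adjoin pQ) => //.
  exact: (transcendental_mod pP).
by apply: h00; apply: TP => //; exact: QP.
Qed.

End HeightOne.

(** * Sections and charts *)

Section Sheaf.
Variable X : scheme.
Local Notation O := (scheme_sheaf X).
Implicit Types (U V W N : opens X).

Lemma restr_irr U V (VU VU' : V `<=` U) (s : Gamma X U) :
  restr O VU s = restr O VU' s.
Proof. by congr (restr O _ s); apply: Prop_irrelevance. Qed.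

(** Expresses that [s] has a nonzero value in the residue field at [x], without forming stalks. It
    includes that [x] lies in [U]. *)
Definition unit_at U (s : Gamma X U) (x : X) :=
  exists N (NU : N `<=` U) (u : Gamma X N), opens_set N x /\ u * restr O NU s = 1.

Lemma unit_at_dom U (s : Gamma X U) x : unit_at s x -> opens_set U x.
Proof. by case=> N [NU [u [Nx _]]]; apply: NU. Qed.

Lemma unit_at_res U V (VU : V `<=` U) (s : Gamma X U) x : opens_set V x ->
  unit_at (restr O VU s) x <-> unit_at s x.
Proof.
move=> Vx; split=> [[N [NV [u [Nx us]]]]|[N [NU [u [Nx us]]]]].
  exists N, (subset_trans NV VU), u; split=> //.
  by rewrite -us (restr_comp VU NV (subset_trans NV VU)).
have NVl : opens_setI N V `<=` N by apply: subIsetl.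
have NVr : opens_setI N V `<=` V by apply: subIsetr.
exists (opens_setI N V), NVr, (restr O NVl u); split; first by split.
rewrite (restr_comp VU NVr (subset_trans NVr VU)).
rewrite (restr_irr _ (subset_trans NVl NU)) -(restr_comp NU NVl).
by rewrite -rmorphM us rmorph1.
Qed.

Lemma unit_at_of_inverse U (s u : Gamma X U) x : u * s = 1 -> opens_set U x -> unit_at s x.
Proof. by move=> us Ux; exists U, (@subset_refl _ _), u; rewrite restr_id. Qed.

Lemma unit_at1 U x : opens_set U x -> unit_at (1 : Gamma X U) x.
Proof. by apply: (@unit_at_of_inverse _ _ 1); rewrite mulr1. Qed.

Lemma unit_atM U (s t : Gamma X U) x : unit_at (s * t) x <-> unit_at s x /\ unit_at t x.
Proof.
split=> [[N [NU [u [Nx us]]]]|[[N [NU [u [Nx us]]]] [M [MU [v [Mx vt]]]]]].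
  split; exists N, NU.
    by exists (u * restr O NU t); rewrite -us rmorphM; split=> //; ring.
  by exists (u * restr O NU s); rewrite -us rmorphM; split=> //; ring.
have lN : opens_setI N M `<=` N by apply: subIsetl.
have lM : opens_setI N M `<=` M by apply: subIsetr.
exists (opens_setI N M), (subset_trans lN NU), (restr O lN u * restr O lM v).
split; first by split.
rewrite rmorphM mulrACA -(restr_comp NU lN) -rmorphM us rmorph1 mul1r.
by rewrite (restr_irr _ (subset_trans lM MU)) -(restr_comp MU lM) -rmorphM vt rmorph1.
Qed.

Lemma unit_atX U (s : Gamma X U) n x : unit_at s x -> unit_at (s ^+ n) x.
Proof.
move=> sx; elim: n => [|n IH]; first by rewrite expr0; exact: (unit_at1 (unit_at_dom sx)).
by rewrite exprS; apply/unit_atM.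
Qed.

Lemma open_unit_at U (s : Gamma X U) : open [set x | unit_at s x].
Proof.
rewrite openE => x [N [NU [u [Nx us]]]]; rewrite /interior nbhsE /=.
by exists N; [split=> //; apply: opensP|move=> y Ny; exists N, NU, u].
Qed.

Definition nonvanishing U (s : Gamma X U) : opens X := Opens (open_unit_at s).

Lemma nonvanishing_sub U (s : Gamma X U) : nonvanishing s `<=` U.
Proof. by move=> x /unit_at_dom. Qed.

(* What remains of affineness for the arguments below: [W] behaves like the
   spectrum of its ring of sections. *)
Record chart W : Prop := Chart {
  chart_prime : forall x, opens_set W x -> prime_ideal [set b : Gamma X W | ~ unit_at b x];
  chart_point : forall P : set (Gamma X W), prime_ideal P ->
    exists2 x, opens_set W x & forall b, unit_at b x <-> ~ P b;
  chart_inj : forall x y, opens_set W x -> opens_set W y ->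
    (forall b : Gamma X W, unit_at b x <-> unit_at b y) -> x = y;
  chart_frac : forall x V (s : Gamma X V), opens_set W x -> opens_set V x ->
    exists (a b : Gamma X W) (NV : nonvanishing b `<=` V),
      unit_at b x /\
      restr O NV s * restr O (@nonvanishing_sub _ b) b =
      restr O (@nonvanishing_sub _ b) a }.

Lemma open_basic_open (A : comPzRingType) (f : A) : open (basic_open f).
Proof.
exists [set f]; apply/seteqP; split=> p /=; first by move=> pf; apply: contra_not pf; apply.
by apply: contra_not => pf _ ->.
Qed.

Lemma basic_open_nbhs (A : comPzRingType) (V : set (spec A)) p : open V -> V p ->
  exists2 h, ~ spec_ideal p h & basic_open h `<=` V.
Proof.
move=> [S ->] /= /existsNP[h /not_implyP[Sh ph]]; exists h => //.
by move=> q /= qh /(_ _ Sh).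
Qed.

(** * Affine open sets and their basic open subsets are charts *)

Section Affine.
Variables (U : opens X) (A : comPzRingType) (psi : spec A -> X)
  (theta : {rmorphism A -> O U}).
Hypothesis psi_inj : injective psi.
Hypothesis psi_range : range psi = U.
Hypothesis psi_cont : continuous psi.
Hypothesis psi_open : forall V : set (spec A), open V -> open (psi @` V).
Hypothesis theta_loc : forall (f : A) (W : opens X) (WU : W `<=` U),
  W = psi @` basic_open f :> set X -> is_localization f (fun a => restr O WU (theta a)).

Let dopen (h : A) : opens X := Opens (psi_open (open_basic_open h)).

Let dopenU h : dopen h `<=` U.
Proof. by rewrite -psi_range => _ [p _ <-]; exists p. Qed.

Let dopenE h p : opens_set (dopen h) (psi p) <-> ~ spec_ideal p h.
Proof. by split=> [[q qh /psi_inj <-]//|ph]; exists p. Qed.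

Let dnbhs p V : opens_set V (psi p) -> exists2 h, ~ spec_ideal p h & dopen h `<=` V.
Proof.
move=> Vp; have oV : open (psi @^-1` V).
  by apply: open_comp (opensP V) => q _; apply: psi_cont.
have [h ph hV] := basic_open_nbhs oV Vp; exists h => //.
by move=> _ [q qh <-]; apply: hV.
Qed.

Lemma affine_unit_at a p : unit_at (theta a) (psi p) <-> ~ spec_ideal p a.
Proof.
split=> [[N [NU [u [Np ua]]]]|pa].
  have [h ph hN] := dnbhs Np.
  have hU := subset_trans hN NU.
  have [_ loc2 loc3] := theta_loc hU (erefl : dopen h = psi @` basic_open h :> set X).
  (* On [dopen h] the inverse [u] is [b / h ^ n], so [h ^ m * (a * b) = h ^ (m + n)] in [A]; with
     [a] in the prime, [h] would be there too. *)
  have [b [n bE]] := loc2 (restr O hN u).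
  have [|m mE] := loc3 (a * b - h ^+ n).
    rewrite !(rmorphB, rmorphM, rmorphXn) -bE.
    have : restr O hN u * restr O hU (theta a) = 1.
      by rewrite -(restr_comp NU hN) -rmorphM ua rmorph1.
    move=> E; rewrite mulrA [X in X * _]mulrC E mul1r subrr //.
  case: (specP p) => p0 pD pM p1 pp pa; apply: ph.
  apply: (@primeX _ _ _ (m + n)); first exact: specP.
  move/eqP: mE; rewrite mulrBr subr_eq0 exprD => /eqP <-.
  by rewrite mulrCA mulrC; apply: (pM).
have [[u ua] _ _] := theta_loc (@dopenU a) (erefl : dopen a = psi @` basic_open a :> set X).
by exists (dopen a), (@dopenU a), u; split=> //; exists p.
Qed.

Lemma affine_frac p V (s : Gamma X V) : opens_set V (psi p) ->
  exists a h (hV : dopen h `<=` V), ~ spec_ideal p h /\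
    restr O hV s * restr O (@dopenU h) (theta h) = restr O (@dopenU h) (theta a).
Proof.
move=> Vp; have [h ph hV] := dnbhs Vp.
have [_ loc2 _] := theta_loc (@dopenU h) (erefl : dopen h = psi @` basic_open h :> set X).
have [a [n aE]] := loc2 (restr O hV s).
(* The exponent [n.+1], instead of [n], keeps this set inside [dopen h] even when [n] is 0. *)
have hh : dopen (h ^+ n.+1) `<=` dopen h.
  move=> _ [q qh <-]; exists q => //; apply: contra_not qh.
  by case: (specP q) => _ _ qM _ _ qh; rewrite exprSr; apply: qM.
exists (a * h), (h ^+ n.+1), (subset_trans hh hV); split.
  by apply: contra_not ph; apply: primeX; apply: specP.
rewrite -(restr_comp hV hh) !(restr_irr (@dopenU (h ^+ n.+1)) (subset_trans hh (@dopenU h))).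
rewrite -!(restr_comp (@dopenU h) hh) -rmorphM; congr (restr O hh _).
by rewrite rmorphM rmorphXn exprSr rmorphM rmorphXn mulrA aE rmorphM.
Qed.

Lemma affine_chart g W : W = psi @` basic_open g :> set X -> chart W.
Proof.
move=> WE; have WU : W `<=` U by rewrite WE; exact: dopenU.
have [[v vg] loc2 loc3] := theta_loc WU WE.
have Wp p : opens_set W (psi p) <-> ~ spec_ideal p g by rewrite WE; exact: dopenE.
have Wx x : opens_set W x -> exists2 p, ~ spec_ideal p g & x = psi p.
  by rewrite WE => -[p pg <-]; exists p.
have ug p : opens_set W (psi p) -> unit_at (restr O WU (theta g)) (psi p).
  by move=> ?; apply: (@unit_at_of_inverse _ _ v).
have loc_unit b a n p : opens_set W (psi p) ->
    b * restr O WU (theta g) ^+ n = restr O WU (theta a) ->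
    unit_at b (psi p) <-> ~ spec_ideal p a.
  move=> Wpp E; rewrite -affine_unit_at -(unit_at_res WU) // -E unit_atM.
  by split=> [bx|[]//]; split=> //; apply/unit_atX/ug.
split.
- move=> _ /Wx[p pg ->]; have Wpp : opens_set W (psi p) by apply/Wp.
  have [p0 pD pM p1 pp] := specP p; split=> /=.
  + by apply/(@loc_unit 0 0 0%N); rewrite // mul0r !rmorph0.
  + move=> a b; have [al [n E]] := loc2 a; have [be [m F]] := loc2 b.
    rewrite (loc_unit _ _ _ _ Wpp E) (loc_unit _ _ _ _ Wpp F) => /contrapT pa /contrapT pb.
    rewrite (loc_unit _ (al * g ^+ m + be * g ^+ n) (n + m)%N) //.
      by apply; apply: pD; rewrite mulrC; apply: pM.
    by rewrite rmorphD !rmorphM !rmorphXn rmorphD !rmorphM !rmorphXn -E -F exprD; ring.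
  + by move=> a b bx /unit_atM[].
  + by apply; exact: unit_at1.
  + by move=> a b; rewrite unit_atM => /not_andP.
- move=> P pP; have [P0 PD PM P1 Pp] := pP.
  pose p := [set a | P (restr O WU (theta a))].
  have prp : prime_ideal p.
    split; rewrite /p /=.
    + by rewrite !rmorph0.
    + by move=> a b pa pb; rewrite !rmorphD; apply: PD.
    + by move=> a b pb; rewrite !rmorphM; apply: PM.
    + by rewrite !rmorph1.
    + by move=> a b; rewrite !rmorphM => /Pp.
  have ng : ~ p g by move=> pg; apply: P1; rewrite -vg; apply: PM.
  exists (psi (Spec prp)); first exact/Wp.
  move=> b; have [a [n E]] := loc2 b; rewrite (loc_unit _ a n) //=; last exact/Wp.
  rewrite /p /= -E; split; apply: contra_not => Pb.
    by rewrite mulrC; apply: PM.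
  case: (Pp _ _ Pb) => // Pg; case: ng; exact: primeX Pg.
- move=> x y /Wx[p pg ->] /Wx[q qg ->] pq; congr psi.
  suff : spec_ideal p = spec_ideal q.
    case: p q {pg qg pq} => p prp [q prq] /= e; rewrite -e in prq *.
    by congr Spec; apply: Prop_irrelevance.
  have pqa a : ~ spec_ideal p a <-> ~ spec_ideal q a.
    rewrite -!affine_unit_at -!(unit_at_res WU); [exact: pq|exact/Wp|exact/Wp].
  by apply/seteqP; split=> a pa; apply: contrapT => /pqa; apply.
- move=> _ V s /Wx[p pg ->] Vp.
  have [|a [h [hV [ph E]]]] := @affine_frac p (opens_setI V W)
      (restr O (@subIsetl _ V W : opens_setI V W `<=` V) s).
    by split=> //; exact/Wp.
  pose b := restr O WU (theta h); pose a' := restr O WU (theta a).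
  have Nh : nonvanishing b `<=` dopen h.
    move=> x bx; have /Wx[q qg xq] := unit_at_dom bx.
    move: bx; rewrite /nonvanishing /= /b xq unit_at_res; last exact/Wp.
    by rewrite affine_unit_at => qh; apply/dopenE.
  have NV : nonvanishing b `<=` V.
    by move=> x /Nh /hV[].
  exists a', b, NV; split.
    by apply/unit_at_res; [exact/Wp|rewrite affine_unit_at].
  have := congr1 (restr O Nh) E; rewrite rmorphM => F.
  rewrite /b /a' !(restr_comp WU _ (subset_trans Nh (@dopenU h))).
  rewrite -!(restr_comp (@dopenU h) Nh) -F; congr (_ * _).
  rewrite (restr_comp hV Nh (subset_trans Nh hV)).
  by rewrite (restr_comp _ _ NV).
Qed.

(** The localization data are returned with the chart because a countable spanning set has to be
    carried from [U] to [W]. *)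
Lemma affine_shrink V x : opens_set U x -> opens_set V x ->
  exists W (WU : W `<=` U) (g : Gamma X U) (v : Gamma X W),
  [/\ opens_set W x, W `<=` V, chart W, v * restr O WU g = 1 &
    forall b : Gamma X W, exists (a : Gamma X U) n,
      b * restr O WU g ^+ n = restr O WU a].
Proof.
rewrite -{1}psi_range => -[p _ <-] /dnbhs[g pg gV].
have [[v vg] loc2 _] := theta_loc (@dopenU g) (erefl : dopen g = psi @` basic_open g :> set X).
exists (dopen g), (@dopenU g), (theta g), v; split=> //; first exact/dopenE.
  exact: affine_chart.
by move=> b; have [a [n E]] := loc2 b; exists (theta a), n.
Qed.

End Affine.

Lemma affine_open_chart U : affine_open O U -> chart U.
Proof.
move=> [A [psi [theta [inj rg cont op loc]]]].
apply: (affine_chart inj rg cont op loc (g := 1)).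
rewrite -rg; congr (_ @` _); apply/seteqP; split=> // p _ /=.
by case: (specP p).
Qed.

Lemma affine_open_shrink U V x : affine_open O U -> opens_set U x -> opens_set V x ->
  exists W (WU : W `<=` U) (g : Gamma X U) (v : Gamma X W),
  [/\ opens_set W x, W `<=` V, chart W, v * restr O WU g = 1 &
    forall b : Gamma X W, exists (a : Gamma X U) n,
      b * restr O WU g ^+ n = restr O WU a].
Proof.
move=> [A [psi [theta [inj rg cont op loc]]]].
exact: (affine_shrink inj rg cont op loc).
Qed.

End Sheaf.

(** * Integral schemes *)

Section Integral.
Variable X : scheme.
Hypothesis X_integral : integral X.
Local Notation O := (scheme_sheaf X).
Implicit Types (U V W N : opens X).

Lemma sections1_neq0 U : U !=set0 -> (1 : Gamma X U) <> 0.
Proof. by move=> /(X_integral.2 U)[]. Qed.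

Lemma sections_domain U (a b : Gamma X U) : U !=set0 -> a * b = 0 -> a = 0 \/ b = 0.
Proof. by move=> /(X_integral.2 U)[_]; apply. Qed.

Lemma sections_empty U (s t : Gamma X U) : opens_set U = set0 -> s = t.
Proof.
move=> U0; pose V (i : False) : opens X := match i with end.
have VU i : V i `<=` U by case: i.
by apply: (sheaf_separated (VU := VU)) => [|[]]; rewrite U0.
Qed.

(** On disjoint [U] and [V], the sections 1 and 0 would glue to an idempotent different from 0 and
    1, which a domain does not have. *)
Lemma opens_meet U V : U !=set0 -> V !=set0 -> (U `&` V) !=set0.
Proof.
move=> U0 V0; apply: contrapT => /set0P/negP; rewrite negbK => /eqP UV0.
pose T := Opens (openU (opensP U) (opensP V)).
pose F (b : bool) := if b then U else V.
pose s (b : bool) : Gamma X (F b) :=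
  match b return Gamma X (F b) with true => 1 | false => 0 end.
have FT b : F b `<=` T by case: b => x Fx; [left|right].
have TF : T `<=` \bigcup_b F b by move=> x [Ux|Vx]; [exists true|exists false].
have [|t tE] := sheaf_glue FT (s := s) TF.
  move=> [] [] /=; rewrite ?rmorph1 ?rmorph0 //; apply: sections_empty => //=.
  by rewrite setIC.
have U1 := tE true; have V0' := tE false; rewrite /s /= in U1 V0'.
have T0 : T !=set0 by case: U0 => x Ux; exists x; left.
have : t * (1 - t) = 0.
  apply: (sheaf_separated (VU := FT)) => // -[] /=; rewrite rmorphM rmorphB rmorph1 rmorph0.
    by rewrite U1 subrr mulr0.
  by rewrite V0' mul0r.
move=> /(sections_domain T0)[t0|/eqP].
  by apply: (sections1_neq0 U0); rewrite -U1 t0 rmorph0.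
rewrite subr_eq0 => /eqP t1.
by apply: (sections1_neq0 V0); rewrite -[RHS]V0' -t1 rmorph1.
Qed.

Lemma dense_opens U : U !=set0 -> dense U.
Proof. by move=> U0 Q Q0 oQ; have := @opens_meet (Opens oQ) U; apply. Qed.

Lemma opens_dense U : dense U -> U !=set0.
Proof. by move=> /(_ setT X_integral.1 openT); rewrite setTI. Qed.

Lemma exists_chart x V : opens_set V x -> exists W, [/\ opens_set W x, W `<=` V & chart W].
Proof.
move=> Vx; have [U [aU Ux]] := scheme_affine x.
by have [W [_ [_ [_ [Wx WV cW _ _]]]]] := affine_open_shrink aU Ux Vx; exists W.
Qed.

(** Locally [s] is a fraction [a / b]. If [a] is nonzero, both [a] and [b] are invertible at the
    point of the zero ideal of the chart, and so is [s]. If [a] is 0 at every point, [s] is locally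
    0. *)
Lemma exists_unit_at U (s : Gamma X U) : s <> 0 -> exists x, unit_at s x.
Proof.
move=> s0; apply: contrapT => /forallNP nu; apply: s0.
pose I := {N : opens X | N `<=` U /\ forall NU : N `<=` U, restr O NU s = 0}.
have IU (i : I) : sval i `<=` U by case: i => N [].
apply: (sheaf_separated (VU := IU)); last first.
  by move=> [N [NU N0]] /=; rewrite N0 rmorph0.
move=> x Ux; have [W [Wx _ cW]] := exists_chart Ux.
have [a [b [NU [bx E]]]] := chart_frac cW s Wx Ux.
have W0 : W !=set0 by exists x.
have [a0|a0] := pselect (a = 0); last first.
  have ab0 : a * b <> 0.
    move=> /(sections_domain W0)[//|b0].
    have [N [NW [u [Nx]]]] := bx; rewrite b0 rmorph0 mulr0 => /esym.
    by apply: sections1_neq0; exists x.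
  have p0 := prime_ideal0 (sections1_neq0 W0) (fun a b => sections_domain W0).
  have [y Wy yP] := chart_point cW p0.
  have /yP/unit_atM[ay yb] : ~ [set 0] (a * b) by [].
  case: (nu y); apply/(unit_at_res NU s) => //.
  have : unit_at (restr O (@nonvanishing_sub _ _ b) a) y by apply/unit_at_res.
  by rewrite -E => /unit_atM[].
have [N [NW [u [Nx ub]]]] := bx.
have Nb : N `<=` nonvanishing b by move=> y Ny; exists N, NW, u.
suff h : forall NU' : N `<=` U, restr O NU' s = 0.
  by exists (exist _ N (conj (subset_trans Nb NU) h)).
move=> NU'; have := congr1 (restr O Nb) E.
rewrite a0 !rmorph0 rmorphM (restr_comp _ _ NU') (restr_comp _ _ NW) => F.
by rewrite -[LHS]mulr1 -ub mulrCA F mulr0.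
Qed.

Lemma restr_inj U V (VU : V `<=` U) : V !=set0 -> injective (restr O VU).
Proof.
move=> V0 s t st; apply/eqP; rewrite -subr_eq0; apply/negPn/negP => /eqP.
move=> /exists_unit_at[x [N [NU [u [Nx us]]]]].
have N0 : N !=set0 by exists x.
have [y [Ny Vy]] := opens_meet N0 V0.
have lN : opens_setI N V `<=` N by apply: subIsetl.
have lV : opens_setI N V `<=` V by apply: subIsetr.
apply: (@sections1_neq0 (opens_setI N V)); first by exists y.
rewrite -(rmorph1 (restr O lN)) -us rmorphM (restr_comp NU lN (subset_trans lV VU)).
by rewrite -(restr_comp VU lV) rmorphB st subrr rmorph0 mulr0.
Qed.

(** These are the sections whose germ lies in the maximal ideal at [x]; closure under addition is
    checked on numerators of fractions in a chart. *)
Lemma not_unit_at_prime U x : opens_set U x -> prime_ideal [set s : Gamma X U | ~ unit_at s x].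
Proof.
move=> Ux; split=> /=.
- move=> [N [NU [u [Nx]]]]; rewrite rmorph0 mulr0 => /esym.
  by apply: sections1_neq0; exists x.
- move=> s t; have [W [Wx _ cW]] := exists_chart Ux.
  have [a [b [NU [bx E]]]] := chart_frac cW s Wx Ux.
  have [a' [b' [NU' [bx' E']]]] := chart_frac cW t Wx Ux.
  pose N := opens_setI (nonvanishing b) (nonvanishing b').
  have lN : N `<=` nonvanishing b by apply: subIsetl.
  have lN' : N `<=` nonvanishing b' by apply: subIsetr.
  have NW := subset_trans lN (@nonvanishing_sub _ _ b).
  have NU0 := subset_trans lN NU.
  have Nx : opens_set N x by split.
  have := congr1 (restr O lN) E; rewrite rmorphM !(restr_comp _ lN NW) (restr_comp _ _ NU0) => F.
  have := congr1 (restr O lN') E'.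
  rewrite rmorphM !(restr_comp _ lN' NW) (restr_comp _ _ NU0) => F'.
  have [P0 PD PM P1 Pp] := chart_prime cW Wx.
  have unF (z : Gamma X U) (c d : Gamma X W) : unit_at d x ->
      restr O NU0 z * restr O NW d = restr O NW c -> unit_at z x <-> unit_at c x.
    move=> dx G; rewrite -(unit_at_res NU0) // -(unit_at_res NW c) // -G unit_atM.
    by split=> [zx|[]//]; split=> //; apply/unit_at_res.
  rewrite (unF _ _ _ bx F) (unF _ _ _ bx' F') => /PM - /(_ b') ax /PM - /(_ b) ax'.
  rewrite (unF (s + t) (b' * a + b * a') (b * b')); first exact: PD.
    by apply/unit_atM.
  by rewrite !(rmorphM, rmorphD) -F -F'; ring.
- by move=> a b bx /unit_atM[].
- by apply; exact: unit_at1.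
- by move=> a b; rewrite unit_atM => /not_andP.
Qed.

End Integral.

(** * Schemes of finite type *)

Section OverField.
Variables (k : closedFieldType) (X : scheme_over k).
Hypothesis k_uncountable : ~ countable [set: k].
Hypothesis X_integral : integral X.
Hypothesis X_finite_type : finite_type X.
Local Notation O := (scheme_sheaf X).
Implicit Types (U V W N : opens X).

Definition scalar_morph U : {rmorphism k -> Gamma X U} :=
  (restr O (@subsetT X U : U `<=` opens_setT X) \o structure_map X)%FUN.

Lemma scalarE U c : scalar U c = scalar_morph U c.
Proof. by []. Qed.

Lemma restr_scalar U V (VU : V `<=` U) c : restr O VU (scalar U c) = scalar V c.
Proof. exact: restr_comp. Qed.

Lemma unit_at_scalar U c x : c != 0 -> opens_set U x -> unit_at (scalar U c) x.
Proof.
move=> c0; apply: (@unit_at_of_inverse _ _ _ (scalar U c^-1)).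
by rewrite !scalarE -rmorphM mulVf // rmorph1.
Qed.

Lemma exists_spanned_chart x V : opens_set V x -> exists W,
  [/\ opens_set W x, W `<=` V, chart W & countably_spanned (scalar_morph W)].
Proof.
move=> Vx; have [n [Us [cov fin]]] := X_finite_type.
have [i _ Ux] := cov x I; have [aU fg] := fin i.
have [W [WU [g [v [Wx WV cW vg loc]]]]] := affine_open_shrink aU Ux Vx.
exists W; split=> //.
have [e eP] := @finitely_generated_monomials _ _ (scalar_morph (Us i)) fg.
(* The index [(m, w)] stands for the monomial [w] divided by [g ^ m]. *)
apply: (@countably_spannedP _ _ _ (nat * seq nat)%type
  (fun w => v ^+ w.1 * restr O WU (e w.2))) => b.
have [a [m E]] := loc b; have [l lE] := eP a.
exists [seq (x.1, (m, x.2)) | x <- l]; rewrite big_map /=.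
have -> : b = v ^+ m * restr O WU a.
  by rewrite -E mulrCA -exprMn vg expr1n mulr1.
rewrite lE rmorph_sum mulr_sumr; apply: eq_bigr => y _.
rewrite rmorphM; have -> : restr O WU (scalar_morph (Us i) y.1) = scalar_morph W y.1.
  exact: restr_scalar.
by rewrite mulrCA.
Qed.

(** The residue field at [x] is [k]; [closed_rational] and [rational_closed] show that this
    characterizes closed points. *)
Definition rational x := forall V (s : Gamma X V), opens_set V x ->
  exists c, ~ unit_at (s - scalar V c) x.

Lemma chart_rational W x : chart W -> opens_set W x ->
  (forall b : Gamma X W, exists c, ~ unit_at (b - scalar W c) x) -> rational x.
Proof.
move=> cW Wx rat V s Vx.
have [a [b [NV [bx E]]]] := chart_frac cW s Wx Vx.
have [P0 PD PM P1 Pp] := chart_prime cW Wx.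
have [al aP] := rat a; have [be bP] := rat b.
have be0 : be != 0.
  by apply: contra_notN bP => /eqP ->; rewrite scalarE rmorph0 subr0.
pose c := al / be; exists c => sx.
suff : ~ unit_at (a - scalar W c * b) x.
  apply; apply/(unit_at_res (@nonvanishing_sub _ _ b)); first exact: bx.
  rewrite rmorphB rmorphM restr_scalar -E -mulrBl -(restr_scalar NV) -rmorphB.
  by apply/unit_atM; split; apply/unit_at_res.
have -> : a - scalar W c * b = (a - scalar W al) + (- scalar W c) * (b - scalar W be).
  have -> : scalar W al = scalar W c * scalar W be by rewrite !scalarE -rmorphM /c divfK.
  by ring.
by apply: PD => //; apply: PM.
Qed.

Lemma closed_rational x : closed [set x] -> rational x.
Proof.
move=> clx; have [W [Wx _ cW span]] := @exists_spanned_chart x (opens_setT X) I.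
have pP := chart_prime cW Wx.
(* With [S = [set 1]] this is a maximal ideal above the prime of [x], whose point lies in the
   closure of [x]. *)
have [|a /[swap] ->|P [pP' sub PS mx]] := @prime_avoiding _ _ [set 1] (prime_is_ideal pP).
- by split=> // a b -> ->; rewrite mulr1.
- by case: pP.
have [y Wy yP] := chart_point cW pP'.
have yx : y = x.
  suff : closure [set x] y by rewrite -(closure_id [set x]).1.
  move=> N; rewrite nbhsE => -[M [oM My] MN]; exists x; split=> //; apply: MN.
  (* Here and below, [chart_frac] is applied to the section 1 of an open set only to get a basic
     neighbourhood [nonvanishing b] inside it. *)
  have [a [b [NV [by_ _]]]] := chart_frac cW (1 : Gamma X (Opens oM)) Wy My.
  by apply: NV; apply: contrapT => /sub; move: by_ => /yP.
apply: (chart_rational cW Wx) => b.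
have [c cP] := nullstellensatz k_uncountable span (countable1 1) pP' PS mx b.
by exists c; rewrite -yx => /yP.
Qed.

(** Let [y] be in the closure of [x]: what is not invertible at [x] is not invertible at [y]. If [b]
    had a nonzero value [c] at [x] but were not invertible at [y], then neither would be [b - c],
    nor the scalar [c]. So [x] and [y] have the same prime. *)
Lemma rational_closed x : rational x -> closed [set x].
Proof.
move=> rx; suff -> : [set x] = closure [set x] by exact: closed_closure.
apply/seteqP; split; first exact: subset_closure.
move=> y cly; have [W [Wy _ cW]] := exists_chart (I : opens_set (opens_setT X) y).
have spec_yx N : opens_set N y -> opens_set N x.
  move=> Ny; have [|z [-> //]] := cly N.
  by rewrite nbhsE; exists N => //; split=> //; exact: opensP.
have Wx := spec_yx _ Wy; apply: (chart_inj cW) => // b.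
split; first exact: (spec_yx (nonvanishing b)).
move=> bx; apply: contrapT => by_; have [c cP] := rx W b Wx.
have [P0 PD PM P1 Pp] := chart_prime cW Wy.
have cy : ~ unit_at (b - scalar W c) y by move=> h; apply: cP; exact: (spec_yx (nonvanishing _) h).
have [c0|c0] := eqVneq c 0.
  by apply: cP; rewrite c0 scalarE rmorph0 subr0.
have := unit_at_scalar c0 Wy.
have -> : scalar W c = b + (-1) * (b - scalar W c) by ring.
by apply: PD => //; apply: PM.
Qed.

(** In a chart, each member of [F] contains the nonvanishing set of some nonzero [f n]. A prime
    maximal among those avoiding all products of the [f n] has its point in every member, and
    [nullstellensatz] for this countable set of products makes the point rational. *)
Lemma exists_generic_closed_point (F : set (set X)) : countable F ->
  (forall D, F D -> open D /\ D !=set0) ->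
  exists2 x, closed [set x] & forall D, F D -> D x.
Proof.
move=> /countable_injP[j jinj] FP.
have [x0 _] := X_integral.1.
have [W [Wx0 _ cW span]] := @exists_spanned_chart x0 (opens_setT X) I.
have W0 : W !=set0 by exists x0.
have dom (a b : Gamma X W) := @sections_domain _ X_integral W a b W0.
have one0 := sections1_neq0 X_integral W0.
have /choice[f fP] : forall n, exists b : Gamma X W, b <> 0 /\
    forall D, F D -> j D = n -> nonvanishing b `<=` D.
  move=> n; have [[D [FD jD]]|noD] := pselect (exists D, F D /\ j D = n); last first.
    by exists 1; split=> // D FD jD; case: noD; exists D.
  have [oD D0] := FP _ FD.
  have [y [Wy Dy]] := opens_meet X_integral W0 (V := Opens oD) D0.
  have [a [b [NV [by_ _]]]] := chart_frac cW (1 : Gamma X (Opens oD)) Wy Dy.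
  exists b; split.
    by move=> b0; have [+ _ _ _ _] := chart_prime cW Wy; rewrite -b0; apply.
  move=> D' FD' jD'; have -> : D' = D by apply: jinj; rewrite ?inE // jD jD'.
  exact: NV.
pose S := range (fun w : seq nat => \prod_(i <- w) f i).
have [||a|P [pP _ PS mx]] := @prime_avoiding _ [set (0 : Gamma X W)] S.
- exact: prime_is_ideal (prime_ideal0 one0 dom).
- split; first by exists [::]; rewrite ?big_nil.
  by move=> _ _ [w _ <-] [w' _ <-]; exists (w ++ w'); rewrite ?big_cat.
- move=> /= -> [w _]; elim: w => [|n w IH]; first by rewrite big_nil.
  by rewrite big_cons => /dom[|//]; case: (fP n).
have [x Wx xP] := chart_point cW pP.
have cS : countable S by exact: (sub_countable (card_image_le _ _) (countableP _)).
exists x; last first.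
  move=> D FD; have [_ /(_ D FD erefl)] := fP (j D); apply; apply/xP => Pf.
  by apply: (PS _ Pf); exists [:: j D]; rewrite ?big_seq1.
apply: rational_closed; apply: (chart_rational cW Wx) => b.
have [c cP] := nullstellensatz k_uncountable span cS pP PS mx b.
by exists c => /xP.
Qed.

Lemma closed_chain_stabilizes (C : nat -> set X) : (forall n, closed (C n)) ->
  (forall n, C n.+1 `<=` C n) -> exists m0, forall n, (m0 <= n)%N -> C m0 `<=` C n.
Proof.
move=> clC CS; have [m [Us [cov fin]]] := X_finite_type.
have Cle n n' : (n <= n')%N -> C n' `<=` C n.
  move=> /subnK <-; elim: (n' - n)%N => // d IH; rewrite addSn.
  exact: subset_trans (CS _) IH.
have /choice[m0 NP] : forall i, exists m0, forall n, (m0 <= n)%N ->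
    C m0 `&` Us i `<=` C n.
  move=> i; have [aU fg] := fin i; have cU := affine_open_chart aU.
  have aT := @finitely_generated_acc _ _ (scalar_morph (Us i)) fg.
  pose J n := [set b : Gamma X (Us i) | forall x, opens_set (Us i) x -> C n x -> ~ unit_at b x].
  have [n|n b Jb x Ux Cx|m0 NP] := aT J.
  - split=> //.
    + by move=> x Ux _; case: (chart_prime cU Ux).
    + move=> a b Ja Jb x Ux Cx; have [_ + _ _ _] := chart_prime cU Ux.
      by apply; [exact: Ja|exact: Jb].
    + move=> a b _ Jb x Ux Cx; have [_ _ + _ _] := chart_prime cU Ux.
      by apply; exact: Jb.
  - by apply: Jb => //; exact: CS.
  exists m0 => n Nn x [CNx Ux]; apply: contrapT => Cnx.
  have [a [b [NV [bx _]]]] :=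
    chart_frac cU (1 : Gamma X (Opens (closed_openC (clC n)))) Ux Cnx.
  have : J m0 b.
    by apply: NP Nn _ _ => y Uy Cy by_; exact: (NV y by_).
  by move=> /(_ x Ux CNx).
exists (\max_(i < m) m0 i) => n Nn x Cx.
have [i _ Ux] := cov x I; apply: (NP i).
  by apply: leq_trans Nn; exact: leq_bigmax.
by split=> //; apply: Cle Cx; exact: leq_bigmax.
Qed.

End OverField.

(** * Decomposition into irreducible sets *)

Section Decomposition.
Variables (X : topologicalType) (P : set X -> Prop).
Hypothesis closed_stabilizes : forall C : nat -> set X, (forall n, closed (C n)) ->
  (forall n, C n.+1 `<=` C n) -> exists N, forall n, (N <= n)%N -> C N `<=` C n.
Hypothesis P_closed : forall Z, P Z -> closed Z.
Hypothesis P0 : P set0.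
Hypothesis PU : forall Y Z, P Y -> P Z -> P (Y `|` Z).
Hypothesis PI : forall Y Z, P Y -> P Z -> P (Y `&` Z).

(** [P] will be both the family of closed sets and that of closed [sigma]-invariant sets. *)
Definition irreducible_among (Z : set X) :=
  [/\ P Z, Z !=set0 & forall Y1 Y2, P Y1 -> P Y2 -> Z = Y1 `|` Y2 ->
        Y1 = Z \/ Y2 = Z].

Definition union_seq (l : seq (set X)) := foldr setU set0 l.

Lemma union_seqP l x : union_seq l x <-> exists2 S, S \in l & S x.
Proof.
elim: l => [|Y l IH]; first by split=> // -[].
split=> /= [[Yx|/IH[S Sl Sx]]|[S]].
- by exists Y; rewrite ?mem_head.
- by exists S; rewrite // inE Sl orbT.
- by rewrite inE => /orP[/eqP->|Sl Sx]; [left|right; apply/IH; exists S].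
Qed.

Lemma exists_decomposition Z : P Z -> exists l : seq (set X),
  (forall S, S \in l -> irreducible_among S) /\ Z = union_seq l.
Proof.
move=> PZ; apply: contrapT => badZ.
pose good Y := exists l : seq (set X),
  (forall S, S \in l -> irreducible_among S) /\ Y = union_seq l.
have union_cat l l' : union_seq (l ++ l') = union_seq l `|` union_seq l'.
  by elim: l => [|S l IH] /=; rewrite ?set0U // IH setUA.
(* Noetherian induction: iterating a choice of strictly smaller sets without decomposition
   contradicts [closed_stabilizes]. *)
have step Y : P Y -> ~ good Y -> exists Y', [/\ P Y', ~ good Y' & Y' `<` Y].
  move=> PY bY; apply: contrapT => /forallNP H.
  have Y0 : Y !=set0.
    apply: contrapT => /set0P/negP; rewrite negbK => /eqP Y0; apply: bY.
    by exists [::].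
  have nirr : ~ irreducible_among Y.
    move=> irr; apply: bY; exists [:: Y]; rewrite /= setU0; split=> // S.
    by rewrite inE => /eqP ->.
  apply: nirr; split=> // Y1 Y2 P1 P2 E; apply: contrapT => /not_orP[n1 n2].
  have [l1 [h1 E1]] : good Y1.
    apply: contrapT => b1; apply: (H Y1); split=> //.
    split; first by rewrite E; exact: subsetUl.
    by move=> YY1; apply: n1; apply/seteqP; split=> //; rewrite E; exact: subsetUl.
  have [l2 [h2 E2]] : good Y2.
    apply: contrapT => b2; apply: (H Y2); split=> //.
    split; first by rewrite E; exact: subsetUr.
    by move=> YY2; apply: n2; apply/seteqP; split=> //; rewrite E; exact: subsetUr.
  apply: bY; exists (l1 ++ l2); rewrite union_cat -E1 -E2; split=> // S.
  by rewrite mem_cat => /orP[/h1|/h2].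
have /choice[g gP] : forall Y, exists Y', P Y -> ~ good Y ->
    [/\ P Y', ~ good Y' & Y' `<` Y].
  move=> Y; have [[PY bY]|h] := pselect (P Y /\ ~ good Y).
    by have [Y' hY'] := step _ PY bY; exists Y'.
  by exists Y => PY bY; case: h.
pose C n := iter n g Z.
have CP n : P (C n) /\ ~ good (C n).
  by elim: n => [//|n [PC bC]]; case: (gP _ PC bC).
have CS n : C n.+1 `<` C n by have [PC bC] := CP n; case: (gP _ PC bC).
have [||N NC] := @closed_stabilizes C.
- by move=> n; apply: P_closed; case: (CP n).
- by move=> n; case: (CS n).
by have [_] := CS N; apply; apply: NC.
Qed.

Lemma irreducible_sub_union Z (l : seq (set X)) : irreducible_among Z ->
  (forall S, S \in l -> P S) -> Z `<=` union_seq l -> exists2 S, S \in l & Z `<=` S.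
Proof.
move=> [PZ Z0 Zirr]; elim: l => [_|S l IH lP]; first by case: Z0 => z Zz /(_ z Zz).
have lP' S' : S' \in l -> P S' by move=> Sl; apply: lP; rewrite inE Sl orbT.
have PS : P S by apply: lP; rewrite mem_head.
have Pl : P (union_seq l).
  elim: l lP' {IH lP} => [//|Y l IH] lP; apply: PU; first by apply: lP; rewrite mem_head.
  by apply: IH => Y' Yl; apply: lP; rewrite inE Yl orbT.
move=> /= Zl.
have [|ZS|Zl'] := Zirr (Z `&` S) (Z `&` union_seq l) (PI PZ PS) (PI PZ Pl).
- by rewrite -setIUr; apply/seteqP; split=> [x Zx|x []//]; split=> //; exact: Zl.
- by exists S; rewrite ?mem_head // -ZS; exact: subIsetr.
have [|S' Sl ZS'] := IH lP'; first by rewrite -{1}Zl'; exact: subIsetr.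
by exists S' => //; rewrite inE Sl orbT.
Qed.

End Decomposition.

Lemma irreducible_closedP (X : topologicalType) (Z : set X) :
  irreducible_closed Z <-> irreducible_among closed Z.
Proof.
split=> [[cZ Z0 nd]|[cZ Z0 irr]]; split=> //.
  move=> Y1 Y2 c1 c2 E; apply: contrapT => /not_orP[n1 n2]; apply: nd.
  exists Y1, Y2; split=> //; split; split.
  - by rewrite E; exact: subsetUl.
  - by move=> h; apply: n1; apply/seteqP; split=> //; rewrite E; exact: subsetUl.
  - by rewrite E; exact: subsetUr.
  - by move=> h; apply: n2; apply/seteqP; split=> //; rewrite E; exact: subsetUr.
move=> [Y1 [Y2 [[c1 c2] [[_ n1] [_ n2]] E]]].
by have [h|h] := irr _ _ c1 c2 E; [apply: n1|apply: n2]; rewrite h.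
Qed.

(** * Invariant closed sets and orbit closures *)

Section Invariance.
Variables (k : fieldType) (X : scheme_over k) (sigma : automorphism X).
Implicit Types (Y Z : set X).

Lemma aut_invariantP Z : aut_invariant sigma Z <-> forall x, Z (sigma x) <-> Z x.
Proof.
split=> [E x|H].
  split=> [|Zx]; last by rewrite -E; exists x.
  by rewrite -{1}E => -[y Zy /(can_inj (aut_funK sigma)) <-].
apply/seteqP; split=> [_ [y Zy <-]|x Zx]; first exact/H.
by exists (aut_inv sigma x); [apply/H|]; rewrite aut_invK.
Qed.

Definition closed_invariant Z := closed Z /\ aut_invariant sigma Z.

Lemma closed_invariant0 : closed_invariant set0.
Proof. by split; [exact: closed0|apply/aut_invariantP]. Qed.

Lemma closed_invariantU Y Z : closed_invariant Y -> closed_invariant Z ->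
  closed_invariant (Y `|` Z).
Proof.
move=> [cY /aut_invariantP iY] [cZ /aut_invariantP iZ]; split; first exact: closedU.
by apply/aut_invariantP => x; split=> -[/iY|/iZ]; by [left|right].
Qed.

Lemma closed_invariantI Y Z : closed_invariant Y -> closed_invariant Z ->
  closed_invariant (Y `&` Z).
Proof.
move=> [cY /aut_invariantP iY] [cZ /aut_invariantP iZ]; split; first exact: closedI.
by apply/aut_invariantP => x; split=> -[/iY ? /iZ ?].
Qed.

Lemma aut_irreducibleP Z :
  aut_irreducible sigma Z <-> irreducible_among closed_invariant Z.
Proof.
split=> [[cZ Z0 iZ nd]|[[cZ iZ] Z0 irr]]; split=> //.
  move=> Y1 Y2 [c1 i1] [c2 i2] E; apply: contrapT => /not_orP[n1 n2]; apply: nd.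
  exists Y1, Y2; split=> //; split; split.
  - by rewrite E; exact: subsetUl.
  - by move=> h; apply: n1; apply/seteqP; split=> //; rewrite E; exact: subsetUl.
  - by rewrite E; exact: subsetUr.
  - by move=> h; apply: n2; apply/seteqP; split=> //; rewrite E; exact: subsetUr.
move=> [Y1 [Y2 [[c1 c2] [i1 i2] [[_ n1] [_ n2]] E]]].
by have [h|h] := irr Y1 Y2 (conj c1 i1) (conj c2 i2) E; [apply: n1|apply: n2]; rewrite h.
Qed.

Lemma closure_aut_invariant Z : aut_invariant sigma Z -> aut_invariant sigma (closure Z).
Proof.
move=> /aut_invariantP iZ; apply/aut_invariantP => x; split=> cx N Nx.
  have : nbhs (aut_inv sigma (sigma x)) N by rewrite aut_funK.
  move=> /(aut_inv_continuous (a := sigma)) /cx[y [Zy Ny]].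
  by exists (aut_inv sigma y); split=> //; apply/iZ; rewrite aut_invK.
have /cx[y [Zy Ny]] := @aut_continuous _ _ sigma _ _ Nx.
by exists (sigma y); split=> //; apply/iZ.
Qed.

Lemma orbit_step x y : aut_orbit sigma x y ->
  aut_orbit sigma x (sigma y) /\ aut_orbit sigma x (aut_inv sigma y).
Proof.
move=> [[n|n] _ <-]; split.
- by exists (Posz n.+1).
- case: n => [|n]; first by exists (Negz 0).
  by exists (Posz n) => //=; rewrite aut_funK.
- case: n => [|n] /=; first by exists (Posz 0) => //=; rewrite aut_invK.
  by exists (Negz n) => //=; rewrite aut_invK.
- by exists (Negz n.+1).
Qed.

Lemma orbit_refl x : aut_orbit sigma x x.
Proof. by exists (Posz 0). Qed.

Lemma orbit_invariant x : aut_invariant sigma (aut_orbit sigma x).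
Proof.
apply/aut_invariantP => y; split=> [/orbit_step[_]|/orbit_step[]//].
by rewrite aut_funK.
Qed.

Lemma orbit_sub_invariant Z x : aut_invariant sigma Z -> Z x -> aut_orbit sigma x `<=` Z.
Proof.
move=> /aut_invariantP iZ Zx _ [[n|n] _ <-] /=.
  by elim: n => //= n IH; apply/iZ.
have inv y : Z y -> Z (aut_inv sigma y) by move=> Zy; apply/iZ; rewrite aut_invK.
by elim: n => [|n IH] /=; apply: (inv).
Qed.

Lemma orbit_closed_point x y : closed [set x] -> aut_orbit sigma x y -> closed [set y].
Proof.
have inv z : closed [set z] -> closed [set aut_inv sigma z].
  move=> cz; have -> : [set aut_inv sigma z] = sigma @^-1` [set z].
    apply/seteqP; split=> w /=; first by move=> ->; rewrite aut_invK.
    by move=> <-; rewrite aut_funK.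
  by apply: closed_comp cz => w _; exact: aut_continuous.
have fwd z : closed [set z] -> closed [set sigma z].
  move=> cz; have -> : [set sigma z] = aut_inv sigma @^-1` [set z].
    apply/seteqP; split=> w /=; first by move=> ->; rewrite aut_funK.
    by move=> <-; rewrite aut_invK.
  by apply: closed_comp cz => w _; exact: aut_inv_continuous.
move=> cx [[n|n] _ <-] /=; first by elim: n => //= n; exact: (fwd).
by elim: n => [|n IH] /=; exact: (inv).
Qed.

(** Of two closed invariant pieces one contains [x], and with it the whole orbit closure. *)
Lemma orbit_closure_irreducible x : aut_irreducible sigma (closure (aut_orbit sigma x)).
Proof.
have xx : closure (aut_orbit sigma x) x by apply: subset_closure; exact: orbit_refl.
have ic := closure_aut_invariant (orbit_invariant x).
have sub Y : closed Y -> aut_invariant sigma Y -> Y x -> closure (aut_orbit sigma x) `<=` Y.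
  move=> cY iY Yx; rewrite [X in _ `<=` X](closure_id Y).1 //; apply: closure_subset.
  exact: orbit_sub_invariant.
apply/aut_irreducibleP; split; first by split=> //; exact: closed_closure.
  by exists x.
move=> Y1 Y2 [c1 i1] [c2 i2] E; move: (xx); rewrite {1}E => -[Yx|Yx]; [left|right].
  by apply/seteqP; split; [rewrite E; exact: subsetUl|exact: sub].
by apply/seteqP; split; [rewrite E; exact: subsetUr|exact: sub].
Qed.

Lemma iter_invK n x : iter n sigma (iter n (aut_inv sigma) x) = x.
Proof. by elim: n x => // n IH x; rewrite iterSr [iter n.+1 _ x]iterS aut_invK. Qed.

End Invariance.

(** * Codimension one and germs *)

Section CodimOne.
Variables (k : closedFieldType) (X : scheme_over k).
Hypothesis X_integral : integral X.
Hypothesis X_finite_type : finite_type X.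
Variable sigma : automorphism X.
Implicit Types (Y Z : set X).

Lemma irreducible_closedT : irreducible_closed [set: X].
Proof.
apply/irreducible_closedP; split; first exact: closedT.
  exact: X_integral.1.
move=> Y1 Y2 c1 c2 E; apply: contrapT => /not_orP[n1 n2].
have [||x [x1 x2]] := @opens_meet X X_integral (Opens (closed_openC c1)) (Opens (closed_openC c2)).
- apply: contrapT => /set0P/negP; rewrite negbK => /eqP/= h; apply: n1.
  by rewrite -(setCK Y1) h setC0.
- apply: contrapT => /set0P/negP; rewrite negbK => /eqP/= h; apply: n2.
  by rewrite -(setCK Y2) h setC0.
by have : [set: X] x by []; rewrite E => -[].
Qed.

(** Let [Z'] in [Z] have codimension exactly one, and let [Y] be proper, [sigma]-irreducible and
    strictly larger than [Z]. Then [Y] is the closure of the difference of [Y] and [Z], so the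
    irreducible pieces of [Y] not contained in [Z] cover [Y], and one contains [Z']. Being proper it
    equals [Z'], which is in [Z]: a contradiction. *)
Lemma codim_one_maximal Z : aut_irreducible sigma Z -> has_codim Z 1 ->
  maximal_aut_irreducible sigma Z.
Proof.
move=> irrZ [[Z' [irrZ' ZZ' ch1 nch2]] chZ].
have ZT : Z <> setT.
  move=> ZT; have [|c [c0 _ /(_ 0%N isT)]] := chZ setT irreducible_closedT.
    by rewrite ZT.
  by rewrite c0 => -[_]; apply.
split=> // Y irrY YT ZY; apply: contrapT => nYZ.
have Z'max C : irreducible_closed C -> Z' `<=` C -> C `<=` Y -> C = Z'.
  move=> irrC Z'C CY; apply: contrapT => nCZ'; apply: nch2.
  exists (fun i => if i is i'.+1 then (if i' is 0%N then C else setT) else Z').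
  split=> [//|[|[|i]] //= _|[|[|i]] //= _]; try exact: irreducible_closedT.
  - by split=> // CZ'; apply: nCZ'; apply/seteqP.
  - split=> // TC; apply: YT; apply/seteqP; split=> // x _.
    by apply: CY; apply: TC.
have /aut_irreducibleP[[cY iY] Y0 Yirr] := irrY.
have /aut_irreducibleP[[cZ iZ] Z0 Zirr] := irrZ.
pose D := closure (Y `\` Z).
have DY : D = Y.
  have [] // : Z = Y \/ D = Y; last by move=> ZeY; case: nYZ.
  apply: Yirr; first by split.
    split; first exact: closed_closure.
    apply: closure_aut_invariant; apply/aut_invariantP => x.
    move/aut_invariantP: iY => iY; move/aut_invariantP: iZ => iZ.
    by split=> -[/iY ? /iZ ?].
  apply/seteqP; split=> x.
    move=> Yx; have [Zx|nZx] := pselect (Z x); [by left|right].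
    by apply: subset_closure.
  move=> [/ZY//|]; rewrite (closure_id Y).1 //; apply: closure_subset.
  exact: subDsetl.
have [l [lirr lE]] := exists_decomposition (closed_chain_stabilizes X_finite_type)
  (fun _ h => h) cY.
pose l' := [seq S <- l | `[< ~ S `<=` Z >]].
have cl' : closed (union_seq l').
  have : forall S, S \in l' -> closed S.
    by move=> S; rewrite mem_filter => /andP[_ /lirr[]].
  elim: {+}l' => [|S m IH] h; first exact: closed0.
  apply: closedU; first by apply: h; rewrite mem_head.
  by apply: IH => S' Sm; apply: h; rewrite inE Sm orbT.
have Yl' : Y `<=` union_seq l'.
  rewrite -{1}DY (closure_id (union_seq l')).1 //; apply: closure_subset => x [Yx nZx].
  move: Yx; rewrite lE => /union_seqP[S Sl Sx]; apply/union_seqP; exists S => //.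
  by rewrite mem_filter Sl andbT; apply/asboolP => /(_ _ Sx).
have [||||||S] := @irreducible_sub_union X closed _ _ _ Z' l'.
- exact: closed0.
- by move=> ? ?; exact: closedU.
- by move=> ? ?; exact: closedI.
- exact/irreducible_closedP.
- by move=> S; rewrite mem_filter => /andP[_ /lirr[]].
- by move=> x /ZZ' /ZY /Yl'.
rewrite mem_filter => /andP[/asboolP nSZ Sl] Z'S; apply: nSZ.
rewrite (Z'max S) //; first by apply/irreducible_closedP; exact: lirr.
by move=> x Sx; rewrite lE; apply/union_seqP; exists S.
Qed.

End CodimOne.

(** * Germs of rational functions and their values *)

Section Germs.
Variables (k : closedFieldType) (X : scheme_over k).
Hypothesis k_uncountable : ~ countable [set: k].
Hypothesis X_integral : integral X.
Hypothesis X_finite_type : finite_type X.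
Variable sigma : automorphism X.
Local Notation O := (scheme_sheaf X).
Implicit Types (U V W : opens X).

Lemma unit_at_comorph U (s : Gamma X U) x :
  unit_at (aut_comorph sigma s) x <-> unit_at s (sigma x).
Proof.
split=> [[N [NU [u [Nx us]]]]|[N [NU [u [Nx us]]]]]; last first.
  exists (opens_preimage (aut_continuous (a := sigma)) N), (preimage_subset NU).
  exists (aut_comorph sigma u).
  by split=> //; rewrite -aut_comorph_restr -rmorphM us rmorph1.
pose M := opens_preimage (aut_inv_continuous (a := sigma)) N.
have MU : M `<=` U by move=> y /NU /=; rewrite /preimage /= aut_invK.
pose M' := opens_preimage (aut_continuous (a := sigma)) M.
(* [M'] and [N] have the same points but are different open-set records, so [u] is carried over by a
   restriction. *)
have MN : M' `<=` N by move=> y; rewrite /M' /M /= /preimage /= aut_funK.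
have [g gK Kg] := aut_comorph_bij sigma M.
exists M, MU, (g (restr O MN u)); split; first by rewrite /M /= /preimage /= aut_funK.
apply: (can_inj gK); rewrite rmorphM rmorph1 Kg aut_comorph_restr.
rewrite -[RHS](rmorph1 (restr O MN)) -us rmorphM; congr (_ * _).
exact/esym/restr_comp.
Qed.

Lemma ratgerm_agree (g h : ratgerm X) : \pi_(ratfun X) g = \pi_(ratfun X) h ->
  forall U (Ug : U `<=` germ_dom g) (Uh : U `<=` germ_dom h),
  restr O Ug (germ_val g) = restr O Uh (germ_val h).
Proof.
move=> /eqmodP/asboolP[W [Wg [Wh [dW E]]]] U Ug Uh.
have [U0|U0] := pselect (U !=set0); last first.
  by apply: sections_empty; apply/eqP; apply: contrapT => /negP/set0P.
have [x [Ux Wx]] := opens_meet X_integral U0 (opens_dense X_integral dW).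
have lU : opens_setI U W `<=` U by apply: subIsetl.
have lW : opens_setI U W `<=` W by apply: subIsetr.
apply: (restr_inj X_integral (VU := lU)); first by exists x.
rewrite (restr_comp Ug lU (subset_trans lU Ug)) (restr_comp Uh lU (subset_trans lU Uh)).
rewrite (restr_irr _ (subset_trans lW Wg)) -(restr_comp Wg lW) E.
by rewrite (restr_comp _ _ (subset_trans lU Uh)).
Qed.

Lemma ratgerm_eq (g h : ratgerm X) U (Ug : U `<=` germ_dom g) (Uh : U `<=` germ_dom h) :
  U !=set0 -> restr O Ug (germ_val g) = restr O Uh (germ_val h) ->
  \pi_(ratfun X) g = \pi_(ratfun X) h.
Proof.
move=> U0 E; apply/eqmodP/asboolP; exists U, Ug, Uh; split=> //.
exact: dense_opens.
Qed.

Lemma ratgerm_const (g : ratgerm X) c : germ_val g = scalar _ c ->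
  \pi_(ratfun X) g = ratconst X c.
Proof.
move=> E; rewrite /ratconst.
apply: (@ratgerm_eq _ (RatGerm (@dense_opens_setT _ X) (scalar (opens_setT X) c))
  (germ_dom g) (@subset_refl _ _) (@subsetT _ _)).
  exact: (opens_dense X_integral (@germ_dense _ _ g)).
by rewrite E /= !restr_scalar.
Qed.

Lemma iter_pullback_pi n (g : ratgerm X) :
  iter n (ratfun_pullback sigma) (\pi_(ratfun X) g) =
  \pi_(ratfun X) (iter n (germ_pullback sigma) g).
Proof. by elim: n => //= n ->; rewrite ratfun_pullback_pi. Qed.

Lemma iter_pullback_value n (g : ratgerm X) x :
  (opens_set (germ_dom (iter n (germ_pullback sigma) g)) x <->
     opens_set (germ_dom g) (iter n sigma x)) /\
  forall c, unit_at (germ_val (iter n (germ_pullback sigma) g) - scalar _ c) x <->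
     unit_at (germ_val g - scalar _ c) (iter n sigma x).
Proof.
elim: n x => [//|n IH] x; have [IHd IHv] := IH (sigma x).
rewrite (iterSr n sigma); split; first exact: IHd.
by move=> c; rewrite -IHv -unit_at_comorph rmorphB aut_comorph_scalar.
Qed.

(* A rational function fixed by the [n]-th power of [sigma] takes the same value at
   [x] and [sigma^n x], taking the value [c] at [x] meaning here that the
   difference with [c] is not a unit at [x]. *)
Lemma invariant_value n (g : ratgerm X) x c :
  iter n (ratfun_pullback sigma) (\pi_(ratfun X) g) = \pi_(ratfun X) g ->
  opens_set (germ_dom g) x -> opens_set (germ_dom g) (iter n sigma x) ->
  unit_at (germ_val g - scalar _ c) (iter n sigma x) <->
  unit_at (germ_val g - scalar _ c) x.
Proof.
rewrite iter_pullback_pi => E gx gnx.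
have [dn vn] := iter_pullback_value n g x.
set h := iter n (germ_pullback sigma) g in E dn vn.
have hx : opens_set (germ_dom h) x by apply/dn.
pose U := opens_setI (germ_dom h) (germ_dom g).
have Uh : U `<=` germ_dom h by apply: subIsetl.
have Ug : U `<=` germ_dom g by apply: subIsetr.
have Ux : opens_set U x by split.
rewrite -vn -(unit_at_res Uh) // -(unit_at_res Ug) // !rmorphB !restr_scalar.
by rewrite (ratgerm_agree E Uh Ug).
Qed.

Lemma no_dense_orbit m (f : ratfun X) : (0 < m)%N -> nonconstant f ->
  iter m (ratfun_pullback sigma) f = f ->
  ~ exists x, closed [set x] /\ dense (aut_orbit sigma x).
Proof.
move=> m0; rewrite -[f]reprK; set g := repr f => ncf finv [x [clx dx]].
have finvq q : iter (m * q) (ratfun_pullback sigma) (\pi_(ratfun X) g) = \pi_(ratfun X) g.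
  by elim: q => [|q IH]; rewrite ?muln0 // mulnS iterD IH.
(* [R] relates points differing by a power of [sigma ^ m]. They are compared in one jump, since
   points in between may leave the domain of [g]. *)
pose R y z := exists q, iter (m * q) sigma y = z \/ iter (m * q) sigma z = y.
have iter_inj n : injective (iter n sigma).
  by elim: n => [//|n IH] y z /= /(can_inj (aut_funK sigma))/IH.
have Rsub q q' y z : (q <= q')%N -> iter (m * q') sigma y = iter (m * q) sigma z -> R y z.
  move=> qq; rewrite -{1}(subnKC qq) mulnDr iterD => /iter_inj e.
  by exists (q' - q)%N; left.
have RT y z w : R y z -> R w z -> R y w.
  move=> [q [<-|<-]] [q' [e|e]].
  - have [qq|/ltnW qq] := leqP q' q; first exact: Rsub qq (esym e).
    by have [p h] := Rsub _ _ _ _ qq e; exists p; case: h; [right|left].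
  - by exists (q' + q)%N; left; rewrite mulnDr iterD e.
  - by exists (q + q')%N; right; rewrite mulnDr iterD e.
  - have [qq|/ltnW qq] := leqP q' q.
      have -> : iter (m * q) sigma z = iter (m * (q - q')) sigma w.
        by rewrite -e -iterD -mulnDr subnK.
      by exists (q - q')%N; right.
    exists (q' - q)%N; left; rewrite -e -iterD -mulnDr subnK //.
have Rorb y : aut_orbit sigma x y -> exists r : 'I_m, R y (iter r sigma x).
  move=> [[n|n] _ <-].
    exists (Ordinal (ltn_pmod n m0)); exists (n %/ m)%N; right => /=.
    by rewrite -iterD mulnC -divn_eq.
  (* The successor makes [m * q] exceed [n.+1], so the remainder lies between 1 and [m]; the value
     [m] is then treated as the class of 0. *)
  pose q := (n.+1 %/ m).+1.
  have nq : (n.+1 < m * q)%N by rewrite mulnC /q; exact: ltn_ceil.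
  have rm : (m * q - n.+1 < m.+1)%N.
    rewrite ltnS leq_subLR /q mulnS addnC leq_add2r mulnC; exact: leq_trunc_div.
  have e : iter (m * q) sigma (iter n.+1 (aut_inv sigma) x) = iter (m * q - n.+1) sigma x.
    rewrite -{1}(subnK (ltnW nq)) iterD; congr iter.
    exact: iter_invK.
  have := rm; rewrite ltnS leq_eqVlt => /orP[/eqP rm'|rm'].
    exists (Ordinal m0); exists q.-1; left.
    apply: (iter_inj m); rewrite -iterD /=; have -> : (m + m * q.-1 = m * q)%N by rewrite /q -mulnS.
    by rewrite e rm'.
  by exists (Ordinal rm'); exists q; left.
have /choice[c cP] : forall r : 'I_m, exists c, forall y, aut_orbit sigma x y ->
    R y (iter r sigma x) -> opens_set (germ_dom g) y ->
    ~ unit_at (germ_val g - scalar _ c) y.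
  move=> r; have [[y0 [oy0 Ry0 gy0]]|none] := pselect (exists y,
      [/\ aut_orbit sigma x y, R y (iter r sigma x) & opens_set (germ_dom g) y]); last first.
    by exists 0 => y oy Ry gy; case: none; exists y.
  have ry0 := closed_rational k_uncountable X_finite_type (orbit_closed_point clx oy0).
  have [c cP] := ry0 _ (germ_val g) gy0; exists c => y oy Ry gy.
  have [q [e|e]] := RT _ _ _ Ry0 Ry; subst.
    by rewrite (invariant_value c (finvq q)).
  by rewrite -(invariant_value c (finvq q)).
have g0 := opens_dense X_integral (@germ_dense _ _ g).
(* No point of the orbit makes this product invertible, so by density it is invertible nowhere,
   hence 0, and one factor is 0. *)
pose p := \prod_(r < m) (germ_val g - scalar _ (c r)).
have p0 : p = 0.
  apply: contrapT => /(exists_unit_at X_integral)[z pz].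
  have [|y [py oy]] := dx (nonvanishing p) _ (opensP _); first by exists z.
  have [r Ryr] := Rorb _ oy; apply: (cP r y oy Ryr); first exact: unit_at_dom py.
  by move: py; rewrite /= /p (bigD1 r) //= => /unit_atM[].
have pr0 : prime_ideal [set (0 : Gamma X (germ_dom g))].
  apply: prime_ideal0; first exact: (sections1_neq0 X_integral g0).
  by move=> a b; exact: (sections_domain X_integral g0).
have [r _ /eqP] := prime_prod pr0 p0.
rewrite subr_eq0 => /eqP gE; apply: ncf; exists (c r); exact: ratgerm_const.
Qed.

End Germs.

(** * Open sets missed by invariant closed sets *)

Section MissedOpens.
Variables (k : closedFieldType) (X : scheme_over k).
Hypothesis X_integral : integral X.
Hypothesis X_finite_type : finite_type X.
Variable sigma : automorphism X.
Local Notation O := (scheme_sheaf X).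
Implicit Types (U V W : opens X).

Definition sigma_preim V := opens_preimage (aut_continuous (a := sigma)) V.

Definition meet_preim V := opens_setI V (sigma_preim V).

Lemma meet_preiml V : meet_preim V `<=` V. Proof. exact: subIsetl. Qed.

Lemma meet_preimr V : meet_preim V `<=` sigma_preim V. Proof. exact: subIsetr. Qed.

(* The numerator of [sigma (a / b) - a / b]. *)
Definition cross V (a b : Gamma X V) : Gamma X (meet_preim V) :=
  restr O (@meet_preimr V) (aut_comorph sigma a) * restr O (@meet_preiml V) b -
  restr O (@meet_preiml V) a * restr O (@meet_preimr V) (aut_comorph sigma b).

(** [sigma] need not preserve [U], so each [cross] moves to a smaller domain. *)
Fixpoint common_domain U n : opens X := if n is m.+1 then meet_preim (common_domain U m) else U.

(** Since [cross] is [k]-linear in its first argument, the coefficients of a combination never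
    enter: only iterated crosses of the generators occur, and these are countably many. *)
Fixpoint crosses U (E : set (Gamma X U)) n : set (Gamma X (common_domain U n)) :=
  match n return set (Gamma X (common_domain U n)) with
  | 0 => E
  | m.+1 => [set cross ab.1 ab.2 | ab in @crosses U E m `*` @crosses U E m]
  end.

Arguments crosses {U} E n.

Lemma countable_crosses U (E : set (Gamma X U)) n : countable E -> countable (crosses E n).
Proof.
move=> cE; elim: n => [//|n IH] /=.
by apply: sub_countable (card_image_le _ _) _; apply: countableX.
Qed.

Lemma sigma_preim_nonempty U : U !=set0 -> sigma_preim U !=set0.
Proof. by move=> [x Ux]; exists (aut_inv sigma x); rewrite /= /preimage /= aut_invK. Qed.

Lemma meet_preim_nonempty U : U !=set0 -> meet_preim U !=set0.
Proof. by move=> U0; apply: opens_meet => //; exact: sigma_preim_nonempty. Qed.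

Lemma domain_nonempty U n : U !=set0 -> common_domain U n !=set0.
Proof. by move=> U0; elim: n => //= n; exact: meet_preim_nonempty. Qed.

Lemma cross_sum V (l : seq (k * Gamma X V)) a :
  cross (\sum_(x <- l) scalar V x.1 * x.2) a =
  \sum_(x <- l) scalar (meet_preim V) x.1 * cross x.2 a.
Proof.
rewrite /cross !rmorph_sum !mulr_suml -sumrB; apply: eq_bigr => x _.
by rewrite !rmorphM aut_comorph_scalar !restr_scalar; ring.
Qed.

Lemma cross_vanishes V (Z : set X) (a b : Gamma X V) : aut_invariant sigma Z ->
  (forall z, Z z -> ~ unit_at a z) -> forall z, Z z -> ~ unit_at (cross a b) z.
Proof.
move=> /aut_invariantP iZ aZ z Zz /[dup] /unit_at_dom dz.
have pz := not_unit_at_prime X_integral dz.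
apply: (ideal_sub (prime_is_ideal pz)); apply: (ideal_mulr _ (prime_is_ideal pz)).
  rewrite /= unit_at_res; last by case: dz.
  by rewrite unit_at_comorph; apply: aZ; apply/iZ.
by rewrite /= unit_at_res; [exact: aZ|case: dz].
Qed.

Hypothesis no_invariant : forall f : ratfun X, ratfun_pullback sigma f = f ->
  exists c, f = ratconst X c.

(** The hypothesis says that [j / a] is invariant; it is realized as the germ of [j * u] on an open
    set where [u] inverts [a]. *)
Lemma cross_eq0 V (j a : Gamma X V) : V !=set0 -> a <> 0 -> cross j a = 0 ->
  exists c, j = scalar V c * a.
Proof.
move=> V0 /(exists_unit_at X_integral)[x [N [NV [u [Nx ua]]]]] ja.
have N0 : N !=set0 by exists x.
pose r := restr O NV j * u.
pose g := RatGerm (dense_opens X_integral N0) r.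
have [c] : exists c, \pi_(ratfun X) g = ratconst X c.
  apply: no_invariant; rewrite ratfun_pullback_pi.
  apply: (@ratgerm_eq _ _ X_integral (germ_pullback sigma g) g (meet_preim N)
    (@meet_preimr N) (@meet_preiml N)); first exact: meet_preim_nonempty.
  have NVm : meet_preim N `<=` meet_preim V by move=> y [/NV ? /NV ?].
  have NVp : sigma_preim N `<=` sigma_preim V by move=> y /NV.
  rewrite /= /r !rmorphM aut_comorph_restr.
  have ua1 := congr1 (restr O (@meet_preiml N)) ua.
  have ua2 := congr1 (restr O (@meet_preimr N)) (congr1 (aut_comorph sigma) ua).
  have F := congr1 (restr O NVm) ja.
  have e1 (s : Gamma X V) : restr O NVm (restr O (@meet_preiml V) s) =
      restr O (@meet_preiml N) (restr O NV s).
    by rewrite (restr_comp NV _ (subset_trans (@meet_preiml N) NV)); exact: restr_comp.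
  have e2 (s : Gamma X (sigma_preim V)) : restr O NVm (restr O (@meet_preimr V) s) =
      restr O (@meet_preimr N) (restr O (preimage_subset NV : sigma_preim N `<=` sigma_preim V) s).
    rewrite (restr_comp _ _ (subset_trans (@meet_preimr N) NVp)); exact/esym/restr_comp.
  move: ua1 ua2 F; rewrite /cross rmorphB !rmorphM !rmorph1 rmorph0 !e1 !e2 aut_comorph_restr.
  set J' := restr _ _ (restr _ _ (aut_comorph sigma j)).
  set A' := restr _ _ (restr _ _ (aut_comorph sigma a)).
  set A := restr _ _ (restr _ _ a); set J := restr _ _ (restr _ _ j).
  set u1 := restr _ _ u; set u2 := restr _ _ (aut_comorph sigma u).
  move=> h1 h2 /eqP; rewrite subr_eq0 => /eqP h3.
  have -> : J' * u2 = J' * A * u2 * u1 by rewrite -[LHS]mulr1 -h1; ring.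
  by rewrite h3 -[RHS]mulr1 -h2; ring.
move=> /(ratgerm_agree X_integral) /(_ N (@subset_refl _ _) (@subsetT _ _)).
rewrite restr_id /= restr_scalar => rc; exists c.
apply: (restr_inj X_integral (VU := NV)) => //.
by rewrite rmorphM restr_scalar -rc /r -mulrA ua mulr1.
Qed.

Lemma vanishing_cross U (E : set (Gamma X U)) (Z : set X) : U !=set0 ->
  aut_invariant sigma Z ->
  forall (l : nat) n (s : seq (k * Gamma X (common_domain U n))), size s = l ->
  (forall x, x \in s -> crosses E n x.2) ->
  \sum_(x <- s) scalar (common_domain U n) x.1 * x.2 <> 0 ->
  (forall z, Z z -> ~ unit_at (\sum_(x <- s) scalar (common_domain U n) x.1 * x.2) z) ->
  exists n (a : Gamma X (common_domain U n)),
    [/\ crosses E n a, a <> 0 & forall z, Z z -> ~ unit_at a z].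
Proof.
move=> U0 iZ; elim=> [|l IH] n [|[c a] s] //=; first by rewrite big_nil.
move=> [sz] sE; set j := (X in X <> 0) => j0 jZ.
have jE : j = scalar (common_domain U n) c * a + \sum_(x <- s) scalar (common_domain U n) x.1 * x.2.
  by rewrite /j big_cons.
have sE' x : x \in s -> crosses E n x.2 by move=> xs; apply: sE; rewrite inE xs orbT.
have Ea : crosses E n a by apply: (sE (c, a)); rewrite mem_head.
have [a0|a0] := pselect (a = 0).
  by apply: (IH n s) => //; move: jE; rewrite a0 mulr0 add0r => <-.
(* The head term drops out because scalars are fixed by [sigma] and [cross a a] is 0. *)
have jaE : cross j a = \sum_(x <- [seq (x.1, cross x.2 a) | x <- s])
    scalar (common_domain U n.+1) x.1 * x.2.
  rewrite big_map -cross_sum jE /cross !(rmorphD, rmorphM) aut_comorph_scalar !restr_scalar.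
  by ring.
have [ja0|ja0] := pselect (cross j a = 0); last first.
  apply: (IH n.+1 [seq (x.1, cross x.2 a) | x <- s]); first by rewrite size_map.
  - by move=> _ /mapP[x xs ->] /=; exists (x.2, a) => //; split=> //; exact: sE'.
  - by rewrite -jaE.
  - by rewrite -jaE; exact: cross_vanishes.
have [d jd] := cross_eq0 (domain_nonempty n U0) a0 ja0.
have d0 : d != 0.
  by apply/eqP => d0; apply: j0; rewrite jd d0 scalarE rmorph0 mul0r.
exists n, a; split=> // z Zz az; apply: (jZ z Zz); rewrite -/j jd.
by apply/unit_atM; split=> //; apply: unit_at_scalar => //; exact: unit_at_dom az.
Qed.

Lemma missed_opens : exists F : set (set X), [/\ countable F,
  forall D, F D -> open D /\ D !=set0 &
  forall Z, closed_invariant sigma Z -> Z <> setT -> exists2 D, F D & forall z, Z z -> ~ D z].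
Proof.
have [x0 _] := X_integral.1.
have [W [Wx0 _ cW [e eT]]] := exists_spanned_chart X_finite_type (I : opens_set (opens_setT X) x0).
have W0 : W !=set0 by exists x0.
pose G n := [set (nonvanishing a : set X) | a in crosses (range e) n `&` [set a | a <> 0]].
exists (\bigcup_n G n); split.
- apply: bigcup_countable => // n _; apply: sub_countable (card_image_le _ _) _.
  apply: sub_countable (countable_crosses n (_ : countable (range e))).
    by apply: subset_card_le; exact: subIsetl.
  exact: (sub_countable (card_image_le _ _)).
- move=> _ [n _ [a [_ a0] <-]]; split; first exact: opensP.
  exact: exists_unit_at.
- move=> Z [cZ iZ] ZT.
  have CZ0 : (~` Z) !=set0.
    apply: contrapT => /set0P/negP; rewrite negbK => /eqP h.
    by apply: ZT; rewrite -(setCK Z) h setC0.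
  have [y [Wy Zy]] := opens_meet X_integral W0 (V := Opens (closed_openC cZ)) CZ0.
  (* This [b] is a nonzero function on [W], invertible at no point of [Z]. *)
  have [a [b [NZ [by_ _]]]] := chart_frac cW (1 : Gamma X (Opens (closed_openC cZ))) Wy Zy.
  have bspan : finspan (scalar_morph W) e b by rewrite eT.
  have [m [c bE]] := bspan.
  pose s := [seq (c i, e i) | i <- index_iota 0 m].
  have sE : \sum_(x <- s) scalar W x.1 * x.2 = b.
    by rewrite big_map big_mkord bE.
  have [|||n [a' [Ea' a'0 a'Z]]] := @vanishing_cross W (range e) Z W0 iZ _ 0%N s erefl.
  + by move=> _ /mapP[i _ ->] /=; exists i.
  + rewrite /= sE => b0; have [P0 _ _ _ _] := not_unit_at_prime X_integral Wy.
    by apply: P0; rewrite -b0.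
  + by move=> z Zz; rewrite /= sE => /NZ; apply.
  exists (nonvanishing a'); first by exists n => //; exists a'.
  by move=> z Zz; apply: a'Z.
Qed.

End MissedOpens.

(** * The equivalences *)

Section Equivalences.
Variables (k : closedFieldType) (X : scheme_over k).
Hypothesis k_uncountable : ~ countable [set: k].
Hypothesis X_integral : integral X.
Hypothesis X_finite_type : finite_type X.
Variable sigma : automorphism X.
Local Notation O := (scheme_sheaf X).
Implicit Types (U V W : opens X) (Y Z : set X).

Lemma invariant_of_no_dense_orbit :
  ~ (exists x : X, closed [set x] /\ dense (aut_orbit sigma x)) ->
  exists f : ratfun X, nonconstant f /\ ratfun_pullback sigma f = f.
Proof.
move=> nd; apply: contrapT => /forallNP nf; apply: nd.
have [|F [cF FP miss]] := @missed_opens _ _ X_integral X_finite_type sigma.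
  by move=> f ff; apply: contrapT => ncf; apply: (nf f).
have [x clx Fx] := exists_generic_closed_point k_uncountable X_integral X_finite_type cF FP.
exists x; split=> //.
have cT : closure (aut_orbit sigma x) = setT.
  apply: contrapT => cT.
  have [|D FD xD] := miss (closure (aut_orbit sigma x)) _ cT.
    by split; [exact: closed_closure|exact/closure_aut_invariant/orbit_invariant].
  apply: (xD x); last exact: Fx.
  by apply: subset_closure; exact: orbit_refl.
move=> Q [q Qq] oQ; have : closure (aut_orbit sigma x) q by rewrite cT.
by move=> /(_ Q (open_nbhs_nbhs (conj oQ Qq)))[z [? ?]]; exists z.
Qed.

Lemma invariant_of_uncountable_maximal :
  ~ countable [set Z : set X | maximal_aut_irreducible sigma Z] ->
  exists f : ratfun X, nonconstant f /\ ratfun_pullback sigma f = f.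
Proof.
move=> nc; apply: contrapT => /forallNP nf; apply: nc.
have [|F [cF FP miss]] := @missed_opens _ _ X_integral X_finite_type sigma.
  by move=> f ff; apply: contrapT => ncf; apply: (nf f).
(* For open [D] this is the largest closed invariant set missing [D]. A maximal set lies in some
   [C D], hence in a piece of its finite decomposition, and equals that piece. *)
pose C (D : set X) := closure [set x | forall y, aut_orbit sigma x y -> ~ D y].
have CI D : closed_invariant sigma (C D).
  split; first exact: closed_closure.
  apply: closure_aut_invariant; apply/aut_invariantP => x.
  have sub z w : aut_orbit sigma z w -> aut_orbit sigma w `<=` aut_orbit sigma z.
    by move=> zw; apply: orbit_sub_invariant => //; exact: orbit_invariant.
  have xs := (orbit_step (orbit_refl sigma x)).1.
  have sx := (orbit_step (orbit_refl sigma (sigma x))).2; rewrite aut_funK in sx.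
  split=> h y yo; apply: h; first exact: (sub _ _ sx).
  exact: (sub _ _ xs).
have CD D : open D -> C D `<=` ~` D.
  move=> oD; rewrite [X in _ `<=` X](closure_id _).1; last exact: open_closedC.
  by apply: closure_subset => x h Dx; apply: (h x) => //; exact: orbit_refl.
have /choice[l lP] : forall D, exists l : seq (set X),
    (forall S, S \in l -> irreducible_among (closed_invariant sigma) S) /\ C D = union_seq l.
  move=> D; apply: (exists_decomposition (closed_chain_stabilizes X_finite_type)) => //.
  by move=> Z [].
apply: (@sub_countable _ _ _ (\bigcup_(D in F) [set` l D])); last first.
  by apply: bigcup_countable => // D _; apply: finite_set_countable; exact: finite_seq.
apply: subset_card_le => Z [irrZ ZT Zmax].
have /aut_irreducibleP irrZ' := irrZ; have [ciZ Z0 _] := irrZ'.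
have [D FD ZD] := miss Z ciZ ZT; have [oD D0] := FP _ FD; have [lirr lE] := lP D.
have [||||||S Sl ZS] := @irreducible_sub_union X (closed_invariant sigma) _ _ _ Z (l D).
- exact: closed_invariant0.
- by move=> ? ?; exact: closed_invariantU.
- by move=> ? ?; exact: closed_invariantI.
- by [].
- by move=> S /lirr[].
- rewrite -lE => z Zz; apply: subset_closure => y zy; apply: ZD.
  by case: ciZ => _ iZ; exact: (orbit_sub_invariant iZ Zz).
exists D => //=; rewrite -(Zmax S) //; first by apply/aut_irreducibleP; exact: lirr.
move=> ST; case: D0 => d Dd; apply: (CD D oD d) => //.
by rewrite lE; apply/union_seqP; exists S; rewrite // ST.
Qed.

(** * From primes of height one to codimension one *)

Section Codimension.
Variables (W : opens X) (cW : chart W).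
Implicit Types (C : set X).

Definition vanishing_ideal C : set (Gamma X W) :=
  [set b | forall y, C y -> opens_set W y -> ~ unit_at b y].

Lemma vanishing_ideal_prime C x : irreducible_closed C -> C x -> opens_set W x ->
  prime_ideal (vanishing_ideal C).
Proof.
move=> /irreducible_closedP[cC C0 Cirr] Cx Wx; split.
- by move=> y _ Wy; case: (not_unit_at_prime X_integral Wy).
- move=> a b Ia Ib y Cy Wy; case: (not_unit_at_prime X_integral Wy) => _ + _ _ _.
  by apply; [exact: Ia|exact: Ib].
- by move=> a b Ib y Cy Wy /unit_atM[_]; exact: Ib.
- by move=> /(_ x Cx Wx); apply; exact: unit_at1.
move=> a b Iab.
pose V (c : Gamma X W) := C `&` ~` nonvanishing c.
have cV c : closed (V c) by apply: closedI => //; apply: open_closedC; exact: opensP.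
have [|h|h] := Cirr (V a) (V b) (cV a) (cV b).
- apply/seteqP; split=> y; last by case=> -[].
  move=> Cy; have [ay|ay] := pselect (unit_at a y); [right|by left].
  by split=> // by_; apply: (Iab y Cy (unit_at_dom by_)); apply/unit_atM.
- by left=> y; rewrite -h => -[].
- by right=> y; rewrite -h => -[].
Qed.

(** By irreducibility [C2] is not covered by [C1] and the complement of [W], so it has a point in
    [W] off [C1]. *)
Lemma separate_closed C1 C2 x : closed C1 -> irreducible_closed C2 -> C2 x ->
  opens_set W x -> ~ C2 `<=` C1 ->
  exists2 b, vanishing_ideal C1 b & ~ vanishing_ideal C2 b.
Proof.
move=> c1 /irreducible_closedP[c2 _ Cirr] Cx Wx n21.
have [y [C2y Wy C1y]] : exists y, [/\ C2 y, opens_set W y & ~ C1 y].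
  apply: contrapT => none.
  have [|||h|h] := Cirr (C2 `&` C1) (C2 `&` ~` W).
  - exact: closedI.
  - by apply: closedI => //; apply: open_closedC; exact: opensP.
  - apply/seteqP; split=> y; last by case=> -[].
    move=> Cy; have [Wy|Wy] := pselect (opens_set W y); [left|by right].
    by split=> //; apply: contrapT => C1y; apply: none; exists y.
  - by apply: n21; rewrite -h; exact: subIsetr.
  - by move: Cx; rewrite -h => -[].
have [a [b [NV [by_ _]]]] := chart_frac cW (1 : Gamma X (Opens (closed_openC c1))) Wy C1y.
exists b; last by move=> /(_ y C2y Wy).
by move=> z C1z _ /NV; apply.
Qed.

Lemma irreducible_closure_point (x : X) : irreducible_closed (closure [set x]).
Proof.
have xx : closure [set x] x by apply: subset_closure.
apply/irreducible_closedP; split; [exact: closed_closure|by exists x|].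
have sub Y : closed Y -> Y x -> closure [set x] `<=` Y.
  move=> cY Yx; rewrite [X in _ `<=` X](closure_id Y).1 //; apply: closure_subset.
  by move=> _ ->.
move=> Y1 Y2 c1 c2 E; move: (xx); rewrite {1}E => -[Yx|Yx]; [left|right].
  by apply/seteqP; split; [rewrite E; exact: subsetUl|exact: sub].
by apply/seteqP; split; [rewrite E; exact: subsetUr|exact: sub].
Qed.

Lemma codim_chain1 Z : irreducible_closed Z -> Z <> setT -> codim_chain Z 1.
Proof.
move=> irrZ ZT; exists (fun i => if i is 0%N then Z else setT); split=> //.
  by move=> [|i] //= _; exact: irreducible_closedT.
move=> [|i] //= _; split=> // TZ; apply: ZT; apply/seteqP; split=> //.
Qed.

(** A chain of length two would place the vanishing ideal of [c 1] strictly between that of [c 2]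
    and [P], by [separate_closed]. *)
Lemma height_one_codim (P : set (Gamma X W)) x : opens_set W x ->
  (forall b, unit_at b x <-> ~ P b) ->
  (forall Q, prime_ideal Q -> Q `<=` P -> P `<=` Q \/ Q `<=` [set 0]) ->
  ~ codim_chain (closure [set x]) 2.
Proof.
move=> Wx xP ht [c [c0 cirr clt]].
have xx : closure [set x] x by apply: subset_closure.
have [l01 n10] := clt 0%N isT; have [l12 n21] := clt 1%N isT.
have c1x : c 1%N x by apply: l01; rewrite c0.
have c2x : c 2%N x by apply: l12.
have Qp i : (i <= 2)%N -> c i x -> prime_ideal (vanishing_ideal (c i)).
  by move=> i2 cx; exact: (vanishing_ideal_prime (cirr i i2) cx Wx).
have QP i : c i x -> vanishing_ideal (c i) `<=` P.
  by move=> cx b /(_ x cx Wx) bx; apply: contrapT => /xP.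
have cl i : (i <= 2)%N -> closed (c i) by move=> /cirr[].
have [PQ|Q0] := ht _ (Qp 1%N isT c1x) (QP 1%N c1x).
  have [b b0] := separate_closed (cl 0%N isT) (cirr 1%N isT) c1x Wx n10.
  by apply; apply: PQ; apply: (QP 0%N) => //; rewrite c0.
have [b b1] := separate_closed (cl 1%N isT) (cirr 2%N isT) c2x Wx n21.
by apply; rewrite (Q0 _ b1); case: (Qp 2%N isT c2x).
Qed.

End Codimension.

Lemma uncountable_codim_one (f : ratfun X) : nonconstant f ->
  ratfun_pullback sigma f = f ->
  ~ countable [set Z : set X | aut_irreducible sigma Z /\ has_codim Z 1].
Proof.
rewrite -[f]reprK; set g := repr f => ncf finv.
have finvn n : iter n (ratfun_pullback sigma) (\pi_(ratfun X) g) = \pi_(ratfun X) g.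
  by elim: n => //= n ->.
pose U := germ_dom g; pose s := germ_val g.
have U0 : U !=set0 := opens_dense X_integral (@germ_dense _ _ g).
have sc c : s <> scalar U c.
  by move=> E; apply: ncf; exists c; exact: ratgerm_const.
have [x0 Ux0] := U0.
have [W [Wx0 WU cW span]] := exists_spanned_chart X_finite_type Ux0.
have W0 : W !=set0 by exists x0.
have dom (a b : Gamma X W) := @sections_domain _ X_integral W a b W0.
have one0 := sections1_neq0 X_integral W0.
have [|C nC CP] := height_one_fibres one0 dom (f := restr O WU s) k_uncountable span.
  move=> c E; apply: (sc c); apply: (restr_inj X_integral (VU := WU)) => //.
  by rewrite restr_scalar E.
have /choice[x xP] : forall c, exists x, C c -> opens_set W x /\
    ~ unit_at (s - scalar U c) x /\ ~ codim_chain (closure [set x]) 2.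
  move=> c; have [Cc|nCc] := pselect (C c); last by exists x0.
  have [P [pP Pc ht]] := CP c Cc; have [x Wx xP] := chart_point cW pP.
  exists x => _; split=> //; split; last exact: (height_one_codim cW Wx xP ht).
  rewrite -(unit_at_res WU) // rmorphB restr_scalar; exact/xP.
pose Z c := closure (aut_orbit sigma (x c)).
(* The value of [s] is [c] along the orbit by invariance, hence on its closure; this makes the [Z c]
   proper and pairwise distinct. *)
have Zval c y : C c -> Z c y -> opens_set U y -> ~ unit_at (s - scalar U c) y.
  move=> Cc Zy Uy sy; have [Wx [sx _]] := xP c Cc.
  have [|z [[[n|n] _ <-] sz]] := Zy (nonvanishing (s - scalar U c)).
  - by rewrite nbhsE; exists (nonvanishing (s - scalar U c)) => //; split=> //; exact: opensP.
  - apply: sx; rewrite -(invariant_value X_integral c (finvn n)) //; first exact: (WU _ Wx).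
    exact: unit_at_dom sz.
  - apply: sx; rewrite -(iter_invK sigma n.+1 (x c)).
    apply/(invariant_value X_integral c (finvn n.+1)); last exact: sz.
      exact: unit_at_dom sz.
    by rewrite iter_invK; exact: (WU _ Wx).
have ZT c : C c -> Z c <> setT.
  move=> Cc ZT; apply: (sc c); apply/eqP; rewrite -subr_eq0; apply/negPn/negP => /eqP.
  move=> /(exists_unit_at X_integral)[y sy]; apply: (Zval c y Cc _ _ sy); rewrite ?ZT //.
  exact: unit_at_dom sy.
have Zcodim c : C c -> has_codim (Z c) 1.
  move=> Cc; have [Wx [_ nch]] := xP c Cc.
  have sub : closure [set x c] `<=` Z c.
    by apply: closure_subset => _ ->; exact: orbit_refl.
  have ch Y : irreducible_closed Y -> Y `<=` Z c -> codim_chain Y 1.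
    move=> irrY YZ; apply: codim_chain1 => // YT; apply: (ZT c Cc).
    by apply/seteqP; split=> // y _; apply: YZ; rewrite YT.
  split=> //; exists (closure [set x c]); split=> //.
  - exact: irreducible_closure_point.
  - by apply: ch => //; exact: irreducible_closure_point.
have Zinj c c' : C c -> C c' -> Z c = Z c' -> c = c'.
  move=> Cc Cc' E; have [Wx [sx _]] := xP c Cc; have Ux := WU _ Wx.
  have Zx : Z c (x c) by apply: subset_closure; exact: orbit_refl.
  have sx' : ~ unit_at (s - scalar U c') (x c) by apply: Zval => //; rewrite -E.
  apply: contrapT => /eqP; rewrite -subr_eq0 => cc'.
  have pz := not_unit_at_prime X_integral Ux.
  have := ideal_sub (prime_is_ideal pz) sx' sx => /=.
  have -> : s - scalar U c' - (s - scalar U c) = scalar U (c - c').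
    by rewrite [in RHS]scalarE rmorphB -!scalarE; ring.
  by apply; exact: unit_at_scalar.
move=> /countable_injP[j jinj]; apply: nC; apply/countable_injP; exists (j \o Z).
move=> c c'; rewrite !inE => Cc Cc' /= E; apply: Zinj => //.
by apply: jinj; rewrite ?inE //=; split; [exact: orbit_closure_irreducible|exact: Zcodim
  |exact: orbit_closure_irreducible|exact: Zcodim].
Qed.

End Equivalences.

Theorem theorem4p2 (k : closedFieldType) (k_uncountable : ~ countable [set: k])
    (X : scheme_over k) (X_integral : integral X)
    (X_finite_type : finite_type X) (sigma : automorphism X) :
  [<-> (exists f : ratfun X, nonconstant f /\ ratfun_pullback sigma f = f);
       (exists m : nat, (1 <= m)%N /\
          exists f : ratfun X,
            nonconstant f /\ iter m (ratfun_pullback sigma) f = f);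
       ~ (exists x : X, closed [set x] /\ dense (aut_orbit sigma x));
       ~ countable [set Z : set X | maximal_aut_irreducible sigma Z];
       ~ countable [set Z : set X | aut_irreducible sigma Z /\ has_codim Z 1]].
Proof.
have codim1 : (exists f : ratfun X, nonconstant f /\ ratfun_pullback sigma f = f) ->
    ~ countable [set Z : set X | aut_irreducible sigma Z /\ has_codim Z 1].
  by move=> [f [ncf finv]]; apply: uncountable_codim_one ncf finv.
have maximal : ~ countable [set Z : set X | aut_irreducible sigma Z /\ has_codim Z 1] ->
    ~ countable [set Z : set X | maximal_aut_irreducible sigma Z].
  apply: contra_not; apply: sub_countable; apply: subset_card_le => Z [irrZ cZ].
  exact: (codim_one_maximal X_integral X_finite_type irrZ cZ).
have inv := @invariant_of_uncountable_maximal _ _ X_integral X_finite_type sigma.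
(* The first three conditions form one cycle; the other runs from the first to the fifth, the fourth
   and back. The goals below that follow neither arrow directly are composites. *)
tfae.
- by move=> [f [ncf finv]]; exists 1%N; split=> //; exists f.
- move=> [m [m0 [f [ncf finv]]]].
  exact: (no_dense_orbit k_uncountable X_integral X_finite_type m0 ncf finv).
- by move=> /(invariant_of_no_dense_orbit k_uncountable X_integral X_finite_type)/codim1/maximal.
- by move=> /inv/codim1.
- by move=> /maximal/inv.
Qed.
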